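(* Let $n\ge 4$. For every $\mathrm{SU}(n+1)$-invariant metric affine connection $\nabla$ on $\mathbb{S}^{2n+1}$ there are $q\in\mathbb{C}$ and $t\in\mathbb{R}$ such that $$\nabla_XY=\nabla^g_XY+(\mathrm{Re}(q)-1)\big(\Phi(X,Y)\,\xi+\eta(Y)\psi(X)\big)+\mathrm{Im}(q)(\nabla^g_X\psi)(Y)+\Big(t+\frac1n\Big)\eta(X)\psi(Y)$$ for all $X,Y\in\mathfrak{X}(\mathbb{S}^{2n+1})$. Moreover, such a $\nabla$ has totally skew-symmetric torsion if and only if there is $r\in\mathbb{R}$ such that $$\nabla_XY=\nabla^g_XY+r\big(\Phi(X,Y)\,\xi-\eta(X)\psi(Y)+\eta(Y)\psi(X)\big)$$ for all $X,Y\in\mathfrak{X}(\mathbb{S}^{2n+1})$.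
   Context: $\mathrm{SU}(n+1)$ acts on the unit sphere $\mathbb{S}^{2n+1}\subset\mathbb{C}^{n+1}$ by matrix multiplication; write $\tau_\sigma(p)=\sigma p$. For a vector field $X\in\mathfrak{X}(\mathbb{S}^{2n+1})$, $\tau_\sigma(X)$ is the vector field $\tau_\sigma(X)_p=(\tau_\sigma)_*(X_{\sigma^{-1}p})$. An affine connection $\nabla$ is $\mathrm{SU}(n+1)$-invariant if $\tau_\sigma(\nabla_XY)=\nabla_{\tau_\sigma(X)}\tau_\sigma(Y)$ for all $\sigma\in\mathrm{SU}(n+1)$ and all vector fields $X,Y$. $g$ is the canonical Riemannian metric of constant sectional curvature $1$ on $\mathbb{S}^{2n+1}$ and $\nabla^g$ its Levi-Civita connection. $\nabla$ is metric if $\nabla g=0$ (its torsion need not vanish). Its torsion is $T^\nabla(X,Y)=\nabla_XY-\nabla_YX-[X,Y]$, and $\nabla$ has totally skew-symmetric torsion if $\omega_\nabla(X,Y,Z)=g(T^\nabla(X,Y),Z)$ is a $3$-form. Standard Sasakian structure: $N$ is the unit outward normal field of $\mathbb{S}^{2n+1}$, $\xi_z=-\mathbf{i}z$ for $z\in\mathbb{S}^{2n+1}$, and the $(1,1)$-tensor $\psi$ and $1$-form $\eta$ are determined by decomposing $\mathbf{i}X=\psi(X)+\eta(X)N$ into tangent and normal parts, for tangent $X$ (so $\eta(X)=g(X,\xi)$). Finally $\Phi(X,Y)=g(X,\psi(Y))$. *)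

(* Defs.v *)
From HB Require Import structures.
From mathcomp Require Import all_boot all_order all_algebra.
From mathcomp Require Import spectral complex.
From mathcomp Require Import all_classical all_reals all_analysis.

Set Implicit Arguments.
Unset Strict Implicit.
Unset Printing Implicit Defensive.

Import Order.TTheory GRing.Theory Num.Theory.
Import numFieldNormedType.Exports.

Local Open Scope classical_set_scope.
Local Open Scope ring_scope.
Local Open Scope complex_scope.
Local Open Scope sesquilinear_scope.

Local Notation Re := complex.Re.
Local Notation Im := complex.Im.
Local Notation iC := (Complex 0 1).

(** The smooth manifold S^{2n+1}.

    Tangent vectors of the sphere are seen as vectors of the ambient space
    C^{n+1}, so a vector field is a map from the sphere to C^{n+1} which is
    smooth and pointwise tangent. *)

Section Smooth.
Context {R : realType}.

Fixpoint Ck {E : normedModType R} (k : nat) (U : set E) (f : E -> R) : Prop :=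
  match k with
  | 0 => forall x, U x -> {for x, continuous f}
  | j.+1 => (forall x, U x -> differentiable f x) /\
            (forall v, Ck j U ('D_v f))
  end.

Definition smooth_on {E : normedModType R} (U : set E) (f : E -> R) : Prop :=
  forall k, Ck k U f.

End Smooth.

Section Sphere.
Context {R : realType} {n : nat}.

Local Notation V := 'cV[R[i]]_n.+1.

(* The real inner product Re <u, v> of C^{n+1} = R^{2n+2}; restricted to
   tangent vectors, it is the metric g of the unit sphere. *)
Definition rdot (u v : V) : R :=
  \sum_k (Re (u k 0) * Re (v k 0) + Im (u k 0) * Im (v k 0)).

Definition sphere : Type := {z : V | rdot z z == 1}.

(* The real coordinates (Re z_k, Im z_k) of z. *)
Definition realify (z : V) : 'M[R]_(n.+1, 2) :=
  \matrix_(k, j) (if j == 0 then Re (z k 0) else Im (z k 0)).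

(* Restriction to the sphere of a function that is smooth on a neighbourhood. *)
Definition sphere_smooth (f : sphere -> R) : Prop :=
  exists (U : set 'M[R]_(n.+1, 2)) (F : 'M[R]_(n.+1, 2) -> R),
    [/\ open U, (forall p : sphere, U (realify (val p))), smooth_on U F
      & forall p : sphere, f p = F (realify (val p))].

Definition vfield (X : sphere -> V) : Prop :=
  (forall p, rdot (X p) (val p) = 0) /\
  (forall k, sphere_smooth (fun p => Re (X p k 0)) /\
             sphere_smooth (fun p => Im (X p k 0))).

(* t |-> (p + t v) / |p + t v|, a curve of the sphere through p whose velocity
   at t = 0 is v when v is tangent at p (insubd is then never out of range,
   see val_curve). *)
Definition curve (p : sphere) (v : V) (t : R) : sphere :=
  let z := val p + t%:C *: v in insubd p ((Num.sqrt (rdot z z))^-1%:C *: z).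

(* The derivative v(f) of a function along the tangent vector v at p. *)
Definition tderiv (f : sphere -> R) (p : sphere) (v : V) : R :=
  derive1 (fun t : R => f (curve p v t)) 0.

Definition app_vf (X : sphere -> V) (f : sphere -> R) : sphere -> R :=
  fun p => tderiv f p (X p).

(* The bracket [X, Y] f = X (Y f) - Y (X f), evaluated on the real coordinate
   functions f = Re z_k and f = Im z_k. *)
Definition lie_bracket (X Y : sphere -> V) : sphere -> V := fun p =>
  \col_k ((app_vf X (fun a => Re (Y a k 0)) p
           - app_vf Y (fun a => Re (X a k 0)) p)
       +i* (app_vf X (fun a => Im (Y a k 0)) p
           - app_vf Y (fun a => Im (X a k 0)) p)).

(** Affine connections.

    They are operators on all maps from the sphere to C^{n+1}, of which only the
    values on vector fields are meaningful. *)

Definition operator : Type := (sphere -> V) -> (sphere -> V) -> (sphere -> V).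

Record affine_connection (nabla : operator) : Prop := AffineConnection {
  conn_vfield : forall X Y, vfield X -> vfield Y -> vfield (nabla X Y);
  conn_addl : forall X X' Y, vfield X -> vfield X' -> vfield Y ->
    forall p, nabla (fun a => X a + X' a) Y p = nabla X Y p + nabla X' Y p;
  conn_scalel : forall f X Y, sphere_smooth f -> vfield X -> vfield Y ->
    forall p, nabla (fun a => (f a)%:C *: X a) Y p = (f p)%:C *: nabla X Y p;
  conn_addr : forall X Y Y', vfield X -> vfield Y -> vfield Y' ->
    forall p, nabla X (fun a => Y a + Y' a) p = nabla X Y p + nabla X Y' p;
  conn_leibniz : forall f X Y, sphere_smooth f -> vfield X -> vfield Y ->
    forall p, nabla X (fun a => (f a)%:C *: Y a) p =
              (app_vf X f p)%:C *: Y p + (f p)%:C *: nabla X Y p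
}.

(* nabla g = 0 *)
Definition metric_connection (nabla : operator) : Prop :=
  forall X Y Z, vfield X -> vfield Y -> vfield Z -> forall p,
    app_vf X (fun a => rdot (Y a) (Z a)) p =
    rdot (nabla X Y p) (Z p) + rdot (Y p) (nabla X Z p).

Definition torsion (nabla : operator) (X Y : sphere -> V) : sphere -> V :=
  fun p => nabla X Y p - nabla Y X p - lie_bracket X Y p.

Definition is_levi_civita (nabla : operator) : Prop :=
  [/\ affine_connection nabla, metric_connection nabla
    & forall X Y, vfield X -> vfield Y -> forall p, torsion nabla X Y p = 0].

(* The Levi-Civita connection; it is unique on vector fields. *)
Definition levi_civita : operator :=
  xget (fun _ _ _ => 0) [set nabla : operator | is_levi_civita nabla].

(* Linearity in the last two arguments follows from skew-symmetry. *)
Record three_form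
    (w : (sphere -> V) -> (sphere -> V) -> (sphere -> V) -> sphere -> R) : Prop :=
ThreeForm {
  form_smooth : forall X Y Z, vfield X -> vfield Y -> vfield Z ->
    sphere_smooth (w X Y Z);
  form_add : forall X X' Y Z, vfield X -> vfield X' -> vfield Y -> vfield Z ->
    forall p, w (fun a => X a + X' a) Y Z p = w X Y Z p + w X' Y Z p;
  form_scale : forall f X Y Z,
    sphere_smooth f -> vfield X -> vfield Y -> vfield Z ->
    forall p, w (fun a => (f a)%:C *: X a) Y Z p = f p * w X Y Z p;
  form_skew12 : forall X Y Z, vfield X -> vfield Y -> vfield Z ->
    forall p, w Y X Z p = - w X Y Z p;
  form_skew23 : forall X Y Z, vfield X -> vfield Y -> vfield Z ->
    forall p, w X Z Y p = - w X Y Z p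
}.

Definition totally_skew_torsion (nabla : operator) : Prop :=
  three_form (fun X Y Z p => rdot (torsion nabla X Y p) (Z p)).

(** The action of SU(n+1). *)

Definition SU (s : 'M[R[i]]_n.+1) : Prop := s \is unitarymx /\ \det s = 1.

(* p |-> s p; insubd is never out of range for unitary s, see val_sphere_act. *)
Definition sphere_act (s : 'M[R[i]]_n.+1) (p : sphere) : sphere :=
  insubd p (s *m val p).

(* The differential of sphere_act s is v |-> s v on tangent vectors. *)
Definition push (s : 'M[R[i]]_n.+1) (X : sphere -> V) : sphere -> V :=
  fun p => s *m X (sphere_act (invmx s) p).

Definition SU_invariant (nabla : operator) : Prop :=
  forall s, SU s -> forall X Y, vfield X -> vfield Y -> forall p,
    push s (nabla X Y) p = nabla (push s X) (push s Y) p.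

(** The standard Sasakian structure. *)

Definition sasaki_xi (p : sphere) : V := (- iC) *: val p.

(* For v tangent at p, i v = sasaki_psi p v + sasaki_eta p v N with N = p. *)
Definition sasaki_eta (p : sphere) (v : V) : R := rdot (iC *: v) (val p).

Definition sasaki_psi (p : sphere) (v : V) : V :=
  iC *: v - (sasaki_eta p v)%:C *: val p.

Definition sasaki_Phi (p : sphere) (u v : V) : R := rdot u (sasaki_psi p v).

(* (nabla_X sasaki_psi) Y *)
Definition nabla_psi (nabla : operator) (X Y : sphere -> V) : sphere -> V :=
  fun p => nabla X (fun a => sasaki_psi a (Y a)) p - sasaki_psi p (nabla X Y p).

(** The junk values of curve and sphere_act are never taken. *)

Lemma rdotC (u v : V) : rdot u v = rdot v u.
Proof. by apply: eq_bigr => k _; rewrite mulrC [Im _ * _]mulrC. Qed.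

Lemma rdot_herm (u v : V) : rdot u v = Re (((u ^t*) *m v) 0 0).
Proof.
rewrite mxE raddf_sum; apply: eq_bigr => k _.
by rewrite !mxE; case: (u k 0) (v k 0) => [a b] [c d] /=; rewrite mulNr opprK.
Qed.

Lemma rdotDr (u v w : V) : rdot u (v + w) = rdot u v + rdot u w.
Proof.
rewrite -big_split; apply: eq_bigr => k _; rewrite !mxE.
by case: (u k 0) (v k 0) (w k 0) => [a b] [c d] [e f] /=; rewrite !mulrDr addrACA.
Qed.

Lemma rdotZr (u v : V) (t : R) : rdot u (t%:C *: v) = t * rdot u v.
Proof.
rewrite mulr_sumr; apply: eq_bigr => k _; rewrite !mxE.
case: (u k 0) (v k 0) => [a b] [c d] /=.
by rewrite !mul0r subr0 addr0 mulrDr !(mulrCA t).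
Qed.

Lemma rdot_ge0 (u : V) : 0 <= rdot u u.
Proof. by apply: sumr_ge0 => k _; rewrite addr_ge0 // -expr2 sqr_ge0. Qed.

Lemma val_curve (p : sphere) (v : V) (t : R) : rdot v (val p) = 0 ->
  let z := val p + t%:C *: v in
  val (curve p v t) = (Num.sqrt (rdot z z))^-1%:C *: z.
Proof.
move=> vp z; rewrite val_insubd.
have zz : 0 < rdot z z.
  rewrite {2}/z rdotDr rdotZr rdotC [rdot z v]rdotC /z !rdotDr !rdotZr vp [rdot _ v]rdotC vp.
  rewrite (eqP (valP p)) mulr0 addr0 add0r mulrA -expr2.
  by rewrite ltr_pwDl // mulr_ge0 ?sqr_ge0 ?rdot_ge0.
rewrite ifT // rdotZr rdotC rdotZr mulrA -invfM -expr2 sqr_sqrtr ?ltW //.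
by rewrite mulVf // gt_eqF.
Qed.

Lemma val_sphere_act (s : 'M[R[i]]_n.+1) (p : sphere) : s \is unitarymx ->
  val (sphere_act s p) = s *m val p /\
  val (sphere_act (invmx s) p) = invmx s *m val p.
Proof.
have actE t : t \is unitarymx -> val (sphere_act t p) = t *m val p.
  move=> tU; rewrite val_insubd ifT // rdot_herm.
  rewrite trmx_mul map_mxM mulmxA -[_ *m t]mulmxA.
  have -> : t ^t* *m t = 1%:M by rewrite -invmx_unitary // mulVmx // unitarymx_unit.
  by rewrite mulmx1 -rdot_herm (valP p).
by move=> sU; split; apply: actE => //; rewrite invmx_unitary // trmxC_unitary.
Qed.

End Sphere.

Arguments sphere R n : clear implicits.
Arguments operator R n : clear implicits.

(* Main.v *)
Require Import Defs.
From HB Require Import structures.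
From mathcomp Require Import all_boot all_order all_algebra.
From mathcomp Require Import spectral complex.
From mathcomp Require Import fingroup perm ring lra.
From mathcomp Require Import all_classical all_reals all_analysis.

Set Implicit Arguments.
Unset Strict Implicit.
Unset Printing Implicit Defensive.

Import Order.TTheory GRing.Theory Num.Theory.
Import numFieldNormedType.Exports.

Local Open Scope ring_scope.
Local Open Scope complex_scope.

(** The Levi-Civita connection of the sphere is the tangential part of the
    ambient derivative, so T = nabla - nabla^g is a tensor, determined by its
    value at the point e_0 since SU(n+1) acts transitively. There
    (u, v, w) |-> g(T(u, v), w) is a real trilinear form on C^{n+1}, skew in v
    and w, which vanishes when an argument is e_0 and is invariant under the
    stabilizer SU(n). Changing the signs of two coordinates kills every value
    on basis vectors in which a nonzero index occurs an odd number of times (as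
    n >= 4, some nonzero index does not occur); what is left is the index
    pattern (j, j, 0) up to order. Permutations of the coordinates and
    diag(1, i, -i, 1, ...) then leave three real parameters, realized by the
    three terms of the formula. Total skew-symmetry of the torsion, tested on
    (xi, e_j, e_j) and (e_j, i e_j, xi), kills the coefficient of nabla^g psi and
    makes the other two opposite. *)

(** * Smooth functions *)

(** The difference tensor is only real bilinear, since nothing ties the connection to multiplication
    by [i]; hence the form is tested on both [e_k] and [i e_k]. The condition on the determinant is
    the obstacle to isolating one coordinate: a sign or phase put on it has to be compensated on
    another one, which must avoid [e_0] and the indices in play.

    The space of invariant forms is never described. The form of the tensor minus a Sasakian form,
    with coefficients read off three test values, satisfies the same identities and vanishes at
    these values, so a single vanishing statement gives the classification. Tangent spaces do not
    appear as vector spaces either: vectors of C^{n+1} are projected orthogonally, which puts the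
    normal vector in the kernel.

    Since [levi_civita] is defined by choice, its explicit expression rests on both existence and
    uniqueness of a torsion-free metric connection. *)

Section SmoothFunctions.
Context {R : realType} {E : normedModType R}.
Implicit Types (U W : set E) (f g : E -> R) (k : nat).

(** [g - f] vanishes near [x], so its increment is [o(id)] and its differential at [x] is zero; then
    [g = f + (g - f)]. *)
Lemma near_eq_differentiable f g x : (\near x, f x = g x) ->
  differentiable f x -> differentiable g x.
Proof.
move=> fg df.
have fg0 : \forall y \near 0, f (y + x) = g (y + x).
  move: fg; rewrite (near_shift 0 x) /=; apply: filterS => y /=.
  by rewrite subr0.
have hd : (g - f) \o shift x = cst ((g - f) x) + (\0 : {linear E -> R}) +o_ 0 id.
  apply/eqaddoP => e e0; near=> y.
  have fgy : f (y + x) = g (y + x) by near: y; exact: fg0.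
  have fgx : f x = g x by exact: (nbhs_singleton fg).
  rewrite !fctE /= fgy fgx !subrr addr0 subrr normr0.
  by rewrite mulr_ge0 // ltW.
have h0 : differentiable (g - f) x.
  have c0 : continuous (\0 : {linear E -> R}) by move=> y; exact: cst_continuous.
  by apply/diff_locallyP; rewrite (diff_unique c0 hd).
rewrite (_ : g = f + (g - f)); last by rewrite addrC subrK.
exact: differentiableD.
Unshelve. all: by end_near. Qed.

(** Equality on an open set is equality near each of its points, so it passes to directional
    derivatives and the induction goes through. This allows replacing ['D_v] of a sum or product by
    an expression valid on [U] only. *)
Lemma Ck_eq k U f g : open U -> (forall x, U x -> f x = g x) ->
  Ck k U f -> Ck k U g.
Proof.
move=> oU; elim: k f g => [|k IH] f g fg /=.
  move=> fC x Ux; have /fC cf := Ux.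
  have nfg : \forall y \near x, f y = g y.
    by move: (open_nbhs_nbhs (conj oU Ux)); apply: filterS.
  rewrite /prop_for /continuous_at -(fg _ Ux); apply: cvg_trans cf.
  by apply: near_eq_cvg.
move=> [df Df]; split.
  move=> x Ux; have /df dfx := Ux.
  have nfg : \forall y \near x, f y = g y.
    by move: (open_nbhs_nbhs (conj oU Ux)); apply: filterS.
  exact: near_eq_differentiable dfx.
move=> v; apply: IH (Df v) => x Ux.
apply: near_eq_derive.
by move: (open_nbhs_nbhs (conj oU Ux)); apply: filterS.
Qed.

Lemma Ck_sub k U W f : (forall x, W x -> U x) -> Ck k U f -> Ck k W f.
Proof.
move=> WU; elim: k f => [|k IH] f /=; first by move=> fC x /WU /fC.
by move=> [df Df]; split=> [x /WU /df //|v]; apply: IH.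
Qed.

Lemma CkW k U f : Ck k.+1 U f -> Ck k U f.
Proof.
elim: k f => [|k IH] f [df Df].
  by move=> x Ux; apply: differentiable_continuous; apply: df.
by split=> // v; apply: IH; apply: Df.
Qed.

Lemma Ck_cst k U (c : R) : Ck k U (cst c).
Proof.
elim: k c => [|k IH] c /=; first by move=> x _; apply: cst_continuous.
split=> [x _|v]; first exact: differentiable_cst.
rewrite (_ : 'D_v (cst c) = cst 0) //; apply/funext => x; exact: derive_cst.
Qed.

Lemma CkD k U f g : open U -> Ck k U f -> Ck k U g -> Ck k U (f + g).
Proof.
move=> oU; elim: k f g => [|k IH] f g.
  by move=> /= fC gC x Ux; apply: cvgD; [apply: fC|apply: gC].
move=> [df Df] [dg Dg]; split=> [x Ux|v].
  by apply: differentiableD; [apply: df|apply: dg].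
apply: Ck_eq (IH _ _ (Df v) (Dg v)) => // x Ux /=.
by rewrite deriveD //; apply: diff_derivable; [apply: df|apply: dg].
Qed.

Lemma CkM k U f g : open U -> Ck k U f -> Ck k U g -> Ck k U (f * g).
Proof.
move=> oU; elim: k f g => [|k IH] f g.
  by move=> /= fC gC x Ux; apply: cvgM; [apply: fC|apply: gC].
move=> f1 g1; have /= [df Df] := f1; have /= [dg Dg] := g1.
split=> [x Ux|v].
  by apply: differentiableM; [apply: df|apply: dg].
(* The Leibniz rule multiplies derivatives by [f] and [g] themselves, whose order is lowered by
   [CkW] to match the induction hypothesis. *)
have H : Ck k U (f * 'D_v g + g * 'D_v f).
  by apply: CkD => //; apply: IH => //; apply: CkW.
apply: Ck_eq H => // x Ux /=.
by rewrite deriveM //; apply: diff_derivable; [apply: df|apply: dg].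
Qed.

Lemma Ck_lin k U (f : {linear E -> R}) : continuous f -> Ck k U f.
Proof.
move=> fC; case: k => [|k]; first by move=> x _; apply: fC.
split=> [x _|v]; first exact: linear_differentiable.
rewrite (_ : 'D_v f = cst (f v)); first exact: Ck_cst.
apply/funext=> x; rewrite deriveE ?diff_lin //; exact: linear_differentiable.
Qed.

Lemma smooth_on_sub U W f : (forall x, W x -> U x) -> smooth_on U f -> smooth_on W f.
Proof. by move=> WU fS k; apply: Ck_sub (fS k). Qed.

Lemma smooth_onD U f g : open U -> smooth_on U f -> smooth_on U g -> smooth_on U (f + g).
Proof. by move=> oU fS gS k; apply: CkD. Qed.

Lemma smooth_onM U f g : open U -> smooth_on U f -> smooth_on U g -> smooth_on U (f * g).
Proof. by move=> oU fS gS k; apply: CkM. Qed.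

Lemma smooth_on_derive U f v : smooth_on U f -> smooth_on U ('D_v f).
Proof. by move=> fS k; have [_] := fS k.+1; apply. Qed.

Lemma smooth_on_diff U f x : smooth_on U f -> U x -> differentiable f x.
Proof. by move=> fS; have [df _] := fS 1%N; apply: df. Qed.

End SmoothFunctions.

(** * Calculus on the sphere *)

Section SphereCalculus.
Context {R : realType} {n : nat}.

Local Notation V := 'cV[R[i]]_n.+1.
Local Notation Re := complex.Re.
Local Notation Im := complex.Im.
Implicit Types (f g : sphere R n -> R) (p : sphere R n) (u v w : V).

Lemma realifyD u v : realify (u + v) = realify u + realify v.
Proof.
apply/matrixP => k j; rewrite !mxE.
by case: (u k 0) (v k 0) => [a b] [c d]; case: ifP.
Qed.

Lemma realifyZ (t : R) v : realify (t%:C *: v) = t *: realify v.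
Proof.
apply/matrixP => k j; rewrite !mxE.
by case: (v k 0) => [c d]; case: ifP; rewrite /= mul0r ?subr0 ?addr0.
Qed.

Lemma rdotDl u v w : rdot (u + v) w = rdot u w + rdot v w.
Proof. by rewrite rdotC rdotDr !(rdotC w). Qed.

Lemma rdotZl (t : R) u v : rdot (t%:C *: u) v = t * rdot u v.
Proof. by rewrite rdotC rdotZr rdotC. Qed.

Lemma rdotNl u v : rdot (- u) v = - rdot u v.
Proof.
by rewrite -[- u]scaleN1r (_ : -1 = (-1 : R)%:C) ?rdotZl ?mulN1r // rmorphN1.
Qed.

Lemma rdotNr u v : rdot u (- v) = - rdot u v.
Proof. by rewrite rdotC rdotNl rdotC. Qed.

Lemma rdotBl u v w : rdot (u - v) w = rdot u w - rdot v w.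
Proof. by rewrite rdotDl rdotNl. Qed.

Lemma rdotBr u v w : rdot u (v - w) = rdot u v - rdot u w.
Proof. by rewrite rdotDr rdotNr. Qed.

Lemma rdot0l u : rdot 0 u = 0.
Proof. by rewrite -(subrr u) rdotBl subrr. Qed.

Lemma rdot_eq0 u : rdot u u = 0 -> u = 0.
Proof.
move=> /eqP; rewrite psumr_eq0 => [/allP u0|k _]; last first.
  by rewrite -!expr2 addr_ge0 ?sqr_ge0.
apply/matrixP => k j; rewrite ord1 mxE.
have /implyP /(_ isT) := u0 k (mem_index_enum _).
rewrite -!expr2 paddr_eq0 ?sqr_ge0 // !sqrf_eq0.
by case: (u k 0) => a b /= /andP[/eqP -> /eqP ->].
Qed.

Lemma rdot_sphere p : rdot (val p) (val p) = 1.
Proof. exact/eqP/(valP p). Qed.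

(** Abstract form of [curve]: for unit [x] and orthogonal [w], [|x + t w|^2 = 1 + t^2 c] with
    [c = |w|^2]. The normalizing factor is even in [t], so its derivative at 0 vanishes and the
    velocity is [w]. *)
Lemma is_diff_curve (x w : 'M[R]_(n.+1, 2)) (c : R) : 0 <= c ->
  let gam := fun t : R => (Num.sqrt (1 + t ^+ 2 * c))^-1 *: (x + t *: w) in
  differentiable gam 0 /\ 'd gam 0 1 = w.
Proof.
move=> c0 gam; pose g := fun t : R => (Num.sqrt (1 + t ^+ 2 * c))^-1.
have gD : is_derive (0 : R) 1 g 0.
  have h0 : 1 + (0 : R) ^+ 2 * c = 1 by rewrite expr0n mul0r addr0.
  have D1 : is_derive (0 : R) 1 (fun t : R => 1 + t ^+ 2 * c) 0.
    have := is_derive_poly (1 + 'X^2 * c%:P) 0.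
    rewrite (_ : horner _ = fun t => 1 + t ^+ 2 * c); last first.
      by apply/funext => t; rewrite !hornerE.
    by rewrite derivD derivM derivC derivXn !hornerE expr0n /= mul0r.
  have D2 : is_derive (0 : R) 1 (Num.sqrt \o (fun t : R => 1 + t ^+ 2 * c)) 0.
    have D0 : is_derive (1 + (0 : R) ^+ 2 * c) 1 (Num.sqrt : R -> R) (2 * Num.sqrt (1 : R))^-1.
      by rewrite h0; exact: is_derive1_sqrt.
    by have := @is_derive1_comp _ _ (fun t => 1 + t ^+ 2 * c) 0 _ _ D0 D1; rewrite mulr0.
  have := is_deriveV _ D2; rewrite /= h0 sqrtr1 scaler0; apply; exact: oner_neq0.
have hD : is_derive (0 : R) 1 (g * id) 1.
  have := is_deriveM gD (is_derive_id (0 : R) 1).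
  by rewrite scaler0 addr0 /g expr0n mul0r addr0 sqrtr1 invr1 scale1r.
have gd : differentiable g 0 by apply/derivable1_diffP.
have hd : differentiable (g * id) 0 by apply/derivable1_diffP.
have gamE : gam = (fun t => g t *: x) + (fun t => (g * id) t *: w).
  by apply/funext => t; rewrite /gam !fctE scalerDr scalerA.
have d1 := differentiableZl x gd; have d2 := differentiableZl w hd.
split; rewrite gamE; first exact: differentiableD.
have dg0 : 'd g 0 1 = 0 by rewrite -deriveE // derive_val.
have dh1 : 'd (g * id) 0 1 = 1 by rewrite -deriveE // derive_val.
have e1 := etrans (congr1 (fun h => h 1) (diffZl x gd)) (congr1 ( *:%R^~ x) dg0).
have e2 := etrans (congr1 (fun h => h 1) (diffZl w hd)) (congr1 ( *:%R^~ w) dh1).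
have e := etrans (congr1 (fun h => h 1) (diffD d1 d2)) (congr2 +%R e1 e2).
by apply: etrans e _; rewrite /= scale0r add0r scale1r.
Qed.

(** Chain rule along [curve]. Any smooth extension [F] may be taken, so the rules for sums, products
    and linearity in [v] are inherited from the ambient differential. *)
Lemma tderivE f (U : set 'M[R]_(n.+1, 2)) F p v :
  (forall a : sphere R n, U (realify (val a))) -> smooth_on U F ->
  (forall a : sphere R n, f a = F (realify (val a))) -> rdot v (val p) = 0 ->
  tderiv f p v = 'd F (realify (val p)) (realify v).
Proof.
move=> UF FS fF vp; rewrite /tderiv.
pose gam := fun t : R => (Num.sqrt (1 + t ^+ 2 * rdot v v))^-1 *:
  (realify (val p) + t *: realify v).
rewrite (_ : (fun t => f _) = F \o gam); last first.
  apply/funext => t; rewrite fF val_curve // realifyZ realifyD realifyZ.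
  rewrite /gam /=; congr (F ((Num.sqrt _)^-1 *: _)).
  rewrite !rdotDl !rdotDr !rdotZl !rdotZr rdot_sphere (rdotC (val p)) vp.
  by rewrite mulr0 addr0 add0r mulrA expr2.
have [gd gv] := is_diff_curve (realify (val p)) (realify v) (rdot_ge0 v).
have gam0 : gam 0 = realify (val p).
  by rewrite /gam expr0n !mul0r scale0r !addr0 sqrtr1 invr1 scale1r.
have Fd : differentiable F (gam 0) by rewrite gam0; apply: smooth_on_diff FS _.
have FGd := differentiable_comp gd Fd.
rewrite derive1E deriveE // diff_comp //= gam0.
by rewrite gv.
Qed.


Lemma sphere_smooth_cst (c : R) : sphere_smooth (fun _ : sphere R n => c).
Proof.
exists setT, (cst c); split=> //; first exact: openT.
by move=> k; apply: Ck_cst.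
Qed.

Lemma sphere_smooth_lift2 f g : sphere_smooth f -> sphere_smooth g ->
  exists (U : set 'M[R]_(n.+1, 2)) F G,
  [/\ open U, (forall p : sphere R n, U (realify (val p))), smooth_on U F /\ smooth_on U G,
     (forall p, f p = F (realify (val p))) & (forall p, g p = G (realify (val p)))].
Proof.
move=> [U [F [oU pU FS fF]]] [W [G [oW pW GS gG]]].
exists (U `&` W)%classic, F, G; split=> //; first exact: openI.
by split; [apply: smooth_on_sub FS|apply: smooth_on_sub GS] => x [].
Qed.

Lemma sphere_smoothD f g : sphere_smooth f -> sphere_smooth g ->
  sphere_smooth (fun p => f p + g p).
Proof.
move=> fS /(sphere_smooth_lift2 fS) [U [F [G [oU pU [FS GS] fF gG]]]].
by exists U, (F + G); split=> // [|p]; [apply: smooth_onD|rewrite fF gG].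
Qed.

Lemma sphere_smoothM f g : sphere_smooth f -> sphere_smooth g ->
  sphere_smooth (fun p => f p * g p).
Proof.
move=> fS /(sphere_smooth_lift2 fS) [U [F [G [oU pU [FS GS] fF gG]]]].
by exists U, (F * G); split=> // [|p]; [apply: smooth_onM|rewrite fF gG].
Qed.

Lemma sphere_smoothN f : sphere_smooth f -> sphere_smooth (fun p => - f p).
Proof.
move=> /(sphere_smoothM (sphere_smooth_cst (- 1))).
by congr sphere_smooth; apply/funext => p; rewrite mulN1r.
Qed.

Lemma sphere_smooth_sum (I : Type) (r : seq I) (h : I -> sphere R n -> R) :
  (forall i, sphere_smooth (h i)) -> sphere_smooth (fun p => \sum_(i <- r) h i p).
Proof.
move=> hS; elim: r => [|i r IH].
  rewrite (_ : (fun p => _) = (fun=> 0)); first exact: sphere_smooth_cst.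
  by apply/funext => p; rewrite big_nil.
rewrite (_ : (fun p => _) = (fun p => h i p + \sum_(j <- r) h j p)).
  exact: sphere_smoothD.
by apply/funext => p; rewrite big_cons.
Qed.

Lemma linear_entry (k : 'I_n.+1) (j : 'I_2) : exists L : {linear 'M[R]_(n.+1, 2) -> R},
  (L : 'M[R]_(n.+1, 2) -> R) = fun M => M k j.
Proof.
have lin : linear (fun M : 'M[R]_(n.+1, 2) => M k j : R).
  by move=> a x y; rewrite !mxE.
pose m := GRing.isLinear.Build _ _ _ _ _ lin.
pose L : {linear 'M[R]_(n.+1, 2) -> R} := HB.pack (fun M : 'M[R]_(n.+1, 2) => M k j) m.
by exists L.
Qed.

Lemma sphere_smooth_entry k j : sphere_smooth (fun p : sphere R n => realify (val p) k j).
Proof.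
exists setT, (fun M => M k j); split=> //; first exact: openT.
have [L LE] := linear_entry k j; move=> i.
by rewrite -LE; apply: Ck_lin; rewrite LE; exact: coord_continuous.
Qed.

Lemma sphere_smooth_Re k : sphere_smooth (fun p : sphere R n => Re (val p k 0)).
Proof.
have := sphere_smooth_entry k 0; congr sphere_smooth.
by apply/funext => p; rewrite mxE.
Qed.

Lemma sphere_smooth_Im k : sphere_smooth (fun p : sphere R n => Im (val p k 0)).
Proof.
have := sphere_smooth_entry k 1; congr sphere_smooth.
by apply/funext => p; rewrite mxE.
Qed.

Lemma tderivD f g p v : sphere_smooth f -> sphere_smooth g -> rdot v (val p) = 0 ->
  tderiv (fun a => f a + g a) p v = tderiv f p v + tderiv g p v.
Proof.
move=> fS /(sphere_smooth_lift2 fS) [U [F [G [oU pU [FS GS] fF gG]]]] vp.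
have dF := smooth_on_diff FS (pU p); have dG := smooth_on_diff GS (pU p).
rewrite (tderivE pU FS fF vp) (tderivE pU GS gG vp).
have fgE (a : sphere R n) : f a + g a = (F + G) (realify (val a)) by rewrite fF gG.
rewrite (tderivE pU (smooth_onD oU FS GS) fgE vp).
exact: (congr1 (fun h => h _) (diffD dF dG)).
Qed.

Lemma tderivM f g p v : sphere_smooth f -> sphere_smooth g -> rdot v (val p) = 0 ->
  tderiv (fun a => f a * g a) p v = tderiv f p v * g p + f p * tderiv g p v.
Proof.
move=> fS /(sphere_smooth_lift2 fS) [U [F [G [oU pU [FS GS] fF gG]]]] vp.
have dF := smooth_on_diff FS (pU p); have dG := smooth_on_diff GS (pU p).
rewrite (tderivE pU FS fF vp) (tderivE pU GS gG vp).
have fgE (a : sphere R n) : f a * g a = (F * G) (realify (val a)) by rewrite fF gG.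
rewrite (tderivE pU (smooth_onM oU FS GS) fgE vp).
apply: etrans (congr1 (fun h => h _) (diffM dF dG)) _.
rewrite addrC fF gG mulrC; reflexivity.
Qed.

Lemma tderiv_cst (c : R) p v : tderiv (fun _ : sphere R n => c) p v = 0.
Proof. by rewrite /tderiv derive1_cst. Qed.

Lemma tderivN f p v : sphere_smooth f -> rdot v (val p) = 0 ->
  tderiv (fun a => - f a) p v = - tderiv f p v.
Proof.
move=> fS vp; have := tderivM (sphere_smooth_cst (-1)) fS vp.
rewrite tderiv_cst mul0r add0r mulN1r => <-; congr (tderiv _ p v).
by apply/funext => a; rewrite mulN1r.
Qed.

Lemma tderiv_sum (I : Type) (r : seq I) (h : I -> sphere R n -> R) p v :
  (forall i, sphere_smooth (h i)) -> rdot v (val p) = 0 ->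
  tderiv (fun p => \sum_(i <- r) h i p) p v = \sum_(i <- r) tderiv (h i) p v.
Proof.
move=> hS vp; elim: r => [|i r IH].
  rewrite (_ : (fun p => _) = (fun=> 0)) ?tderiv_cst ?big_nil //.
  by apply/funext => a; rewrite big_nil.
rewrite (_ : (fun p => _) = (fun p => h i p + \sum_(j <- r) h j p)).
  by rewrite tderivD // ?IH ?big_cons //; apply: sphere_smooth_sum.
by apply/funext => a; rewrite big_cons.
Qed.

Lemma tderivDv f p u v : sphere_smooth f ->
  rdot u (val p) = 0 -> rdot v (val p) = 0 ->
  tderiv f p (u + v) = tderiv f p u + tderiv f p v.
Proof.
move=> [U [F [oU pU FS fF]]] up vp.
by rewrite !(tderivE pU FS) // ?realifyD ?linearD // rdotDl up vp addr0.
Qed.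

Lemma tderivZv f p (t : R) v : sphere_smooth f -> rdot v (val p) = 0 ->
  tderiv f p (t%:C *: v) = t * tderiv f p v.
Proof.
move=> [U [F [oU pU FS fF]]] vp.
by rewrite !(tderivE pU FS) // ?realifyZ ?linearZ // rdotZl vp mulr0.
Qed.

Lemma tderiv_entry k j p v : rdot v (val p) = 0 ->
  tderiv (fun a : sphere R n => realify (val a) k j) p v = realify v k j.
Proof.
move=> vp; have [L LE] := linear_entry k j.
have LC : continuous L by rewrite LE; exact: coord_continuous.
have LS : smooth_on setT (L : 'M[R]_(n.+1, 2) -> R) by move=> i; exact: Ck_lin.
have LE' (a : sphere R n) : realify (val a) k j = L (realify (val a)) by rewrite LE.
by rewrite (tderivE (fun=> I) LS LE' vp) diff_lin // LE.
Qed.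

Lemma tderiv_Re k p v : rdot v (val p) = 0 ->
  tderiv (fun a : sphere R n => Re (val a k 0)) p v = Re (v k 0).
Proof.
move=> vp; have := tderiv_entry k 0 vp; rewrite mxE /= => <-.
by congr (tderiv _ p v); apply/funext => a; rewrite mxE.
Qed.

Lemma tderiv_Im k p v : rdot v (val p) = 0 ->
  tderiv (fun a : sphere R n => Im (val a k 0)) p v = Im (v k 0).
Proof.
move=> vp; have := tderiv_entry k 1 vp; rewrite mxE /= => <-.
by congr (tderiv _ p v); apply/funext => a; rewrite mxE.
Qed.

(** In real coordinates [X f] is the sum of the coordinates of [X] times the partial derivatives of
    an extension [F], and these are smooth on the same open set as [F]. *)
Lemma sphere_smooth_app_vf X f : vfield X -> sphere_smooth f ->
  sphere_smooth (app_vf X f).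
Proof.
move=> [Xp XS] [U [F [oU pU FS fF]]].
have XkS k j : sphere_smooth (fun p => realify (X p) k j).
  have [XR XI] := XS k.
  case: (eqVneq j 0) => [->|j0]; [move: XR|move: XI]; congr sphere_smooth;
    by apply/funext => p; rewrite mxE ?eqxx // (negbTE j0).
rewrite (_ : app_vf X f = fun p => \sum_k \sum_j
    realify (X p) k j * 'D_(delta_mx k j) F (realify (val p))).
  apply: sphere_smooth_sum => k; apply: sphere_smooth_sum => j.
  apply: sphere_smoothM => //.
  by exists U, ('D_(delta_mx k j) F); split=> //; apply: smooth_on_derive.
apply/funext => p; rewrite /app_vf (tderivE pU FS) //.
rewrite {1}(matrix_sum_delta (realify (X p))) raddf_sum; apply: eq_bigr => k _.
rewrite raddf_sum; apply: eq_bigr => j _.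
rewrite /= linearZ (deriveE _ (smooth_on_diff FS (pU p))).
reflexivity.
Qed.

End SphereCalculus.

(** * The Levi-Civita connection *)

Section LeviCivita.
Context {R : realType} {n : nat}.

Local Notation V := 'cV[R[i]]_n.+1.
Local Notation Re := complex.Re.
Local Notation Im := complex.Im.
Local Notation iC := (Complex (0 : R) 1).
Implicit Types (f : sphere R n -> R) (p : sphere R n) (u v w : V)
  (X Y Z : sphere R n -> V).

Lemma ReD (x y : R[i]) : Re (x + y) = Re x + Re y.
Proof. by case: x y => ? ? []. Qed.

Lemma ImD (x y : R[i]) : Im (x + y) = Im x + Im y.
Proof. by case: x y => ? ? []. Qed.

Lemma ReN (x : R[i]) : Re (- x) = - Re x.
Proof. by case: x. Qed.

Lemma ImN (x : R[i]) : Im (- x) = - Im x.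
Proof. by case: x. Qed.

Lemma ReZ (t : R) (x : R[i]) : Re (t%:C * x) = t * Re x.
Proof. by case: x => a b /=; rewrite mul0r subr0. Qed.

Lemma ImZ (t : R) (x : R[i]) : Im (t%:C * x) = t * Im x.
Proof. by case: x => a b /=; rewrite mul0r addr0. Qed.

Lemma Re_mulI (x : R[i]) : Re (iC * x) = - Im x.
Proof. by case: x => a b /=; rewrite mul0r mul1r sub0r. Qed.

Lemma Im_mulI (x : R[i]) : Im (iC * x) = Re x.
Proof. by case: x => a b /=; rewrite mul0r mul1r add0r. Qed.

Lemma cV_ReIm_eq u v : (forall k, Re (u k 0) = Re (v k 0)) ->
  (forall k, Im (u k 0) = Im (v k 0)) -> u = v.
Proof.
move=> uv1 uv2; apply/matrixP => k j; rewrite ord1.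
by apply/eqP; rewrite eq_complex uv1 uv2 !eqxx.
Qed.

Lemma scaleCAC (t : R) (c : R[i]) v : c *: (t%:C *: v) = t%:C *: (c *: v).
Proof. by rewrite !scalerA mulrC. Qed.

Lemma scaleCD (s t : R) v : (s + t)%:C *: v = s%:C *: v + t%:C *: v.
Proof. by rewrite rmorphD scalerDl. Qed.

Lemma scaleCM (s t : R) v : (s * t)%:C *: v = s%:C *: (t%:C *: v).
Proof. by rewrite rmorphM scalerA. Qed.

Lemma scaleCN (t : R) v : (- t)%:C *: v = - (t%:C *: v).
Proof. by rewrite rmorphN scaleNr. Qed.

Lemma scaleC0 v : (0 : R)%:C *: v = 0.
Proof. by rewrite scale0r. Qed.

Lemma scaleC1 v : (1 : R)%:C *: v = v.
Proof. by rewrite scale1r. Qed.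

Lemma ReDv u v k : Re ((u + v) k 0) = Re (u k 0) + Re (v k 0).
Proof. by rewrite mxE ReD. Qed.

Lemma ImDv u v k : Im ((u + v) k 0) = Im (u k 0) + Im (v k 0).
Proof. by rewrite mxE ImD. Qed.

Lemma ReZv (t : R) v k : Re ((t%:C *: v) k 0) = t * Re (v k 0).
Proof. by rewrite mxE ReZ. Qed.

Lemma ImZv (t : R) v k : Im ((t%:C *: v) k 0) = t * Im (v k 0).
Proof. by rewrite mxE ImZ. Qed.

(** Smoothness without tangency, so that it also covers constant fields, the normal field [val] and
    [i Y]. *)
Definition vsmooth (Y : sphere R n -> V) : Prop :=
  forall k, sphere_smooth (fun p => Re (Y p k 0)) /\
            sphere_smooth (fun p => Im (Y p k 0)).

Lemma vfield_smooth X : vfield X -> vsmooth X. Proof. by case. Qed.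

Lemma vfield_tangent X p : vfield X -> rdot (X p) (val p) = 0.
Proof. by case. Qed.

Lemma vsmoothD X Y : vsmooth X -> vsmooth Y -> vsmooth (fun p => X p + Y p).
Proof.
move=> XS YS k; have [XR XI] := XS k; have [YR YI] := YS k.
split; [have := sphere_smoothD XR YR|have := sphere_smoothD XI YI];
  by congr sphere_smooth; apply/funext => p; rewrite mxE ?ReD ?ImD.
Qed.

Lemma vsmoothZ f X : sphere_smooth f -> vsmooth X -> vsmooth (fun p => (f p)%:C *: X p).
Proof.
move=> fS XS k; have [XR XI] := XS k.
split; [have := sphere_smoothM fS XR|have := sphere_smoothM fS XI];
  by congr sphere_smooth; apply/funext => p; rewrite mxE ?ReZ ?ImZ.
Qed.

Lemma vsmooth_mulI X : vsmooth X -> vsmooth (fun p => iC *: X p).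
Proof.
move=> XS k; have [XR XI] := XS k.
split; [have := sphere_smoothN XI|have := XR];
  by congr sphere_smooth; apply/funext => p; rewrite mxE ?Re_mulI ?Im_mulI.
Qed.

Lemma vsmooth_cst u : vsmooth (fun=> u).
Proof. by move=> k; split; apply: sphere_smooth_cst. Qed.

Lemma vsmooth_val : vsmooth val.
Proof. by move=> k; split; [apply: sphere_smooth_Re|apply: sphere_smooth_Im]. Qed.

Lemma vsmoothN X : vsmooth X -> vsmooth (fun p => - X p).
Proof.
move=> /(vsmoothZ (sphere_smooth_cst (-1))).
by congr vsmooth; apply/funext => p; rewrite scaleCN scaleC1.
Qed.

Lemma sphere_smooth_rdot X Y : vsmooth X -> vsmooth Y ->
  sphere_smooth (fun p => rdot (X p) (Y p)).
Proof.
move=> XS YS; apply: sphere_smooth_sum => k.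
have [XR XI] := XS k; have [YR YI] := YS k.
by apply: sphere_smoothD; apply: sphere_smoothM.
Qed.

Lemma vfieldD X Y : vfield X -> vfield Y -> vfield (fun p => X p + Y p).
Proof.
move=> Xv Yv; split; last exact: vsmoothD (vfield_smooth Xv) (vfield_smooth Yv).
by move=> p; rewrite rdotDl !vfield_tangent ?addr0.
Qed.

Lemma vfieldZ f X : sphere_smooth f -> vfield X -> vfield (fun p => (f p)%:C *: X p).
Proof.
move=> fS Xv; split; last exact: vsmoothZ (vfield_smooth Xv).
by move=> p; rewrite rdotZl vfield_tangent ?mulr0.
Qed.

Lemma vfieldN X : vfield X -> vfield (fun p => - X p).
Proof.
move=> Xv; split; last exact: vsmoothN (vfield_smooth Xv).
by move=> p; rewrite rdotNl vfield_tangent ?oppr0.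
Qed.

Lemma vfieldB X Y : vfield X -> vfield Y -> vfield (fun p => X p - Y p).
Proof. by move=> Xv Yv; apply: vfieldD => //; apply: vfieldN. Qed.

Lemma vfield0 : vfield (fun=> 0 : V).
Proof. by split; [move=> p; rewrite rdot0l|exact: vsmooth_cst]. Qed.

(** The flat derivative of C^{n+1} in direction [v], for maps on the sphere that may have a normal
    component. *)
Definition vderiv Y p v : V :=
  \col_k (tderiv (fun a => Re (Y a k 0)) p v +i* tderiv (fun a => Im (Y a k 0)) p v).

Lemma eq_tderiv (f g : sphere R n -> R) p v : f =1 g -> tderiv f p v = tderiv g p v.
Proof. by move=> /funext ->. Qed.

Lemma vderiv_Re Y p v k : Re (vderiv Y p v k 0) = tderiv (fun a => Re (Y a k 0)) p v.
Proof. by rewrite mxE. Qed.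

Lemma vderiv_Im Y p v k : Im (vderiv Y p v k 0) = tderiv (fun a => Im (Y a k 0)) p v.
Proof. by rewrite mxE. Qed.

Section VectorDerivative.
Variables (p : sphere R n) (v : V) (vp : rdot v (val p) = 0).

Lemma vderivD X Y : vsmooth X -> vsmooth Y ->
  vderiv (fun a => X a + Y a) p v = vderiv X p v + vderiv Y p v.
Proof.
move=> XS YS; apply: cV_ReIm_eq => k; have [XR XI] := XS k; have [YR YI] := YS k.
  rewrite [(_ + _ : V) _ _]mxE ReD !vderiv_Re.
  by apply: etrans (eq_tderiv _ _ _) (tderivD XR YR vp) => a; rewrite mxE ReD.
rewrite [(_ + _ : V) _ _]mxE ImD !vderiv_Im.
by apply: etrans (eq_tderiv _ _ _) (tderivD XI YI vp) => a; rewrite mxE ImD.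
Qed.

Lemma vderivZ f X : sphere_smooth f -> vsmooth X ->
  vderiv (fun a => (f a)%:C *: X a) p v =
  (tderiv f p v)%:C *: X p + (f p)%:C *: vderiv X p v.
Proof.
move=> fS XS; apply: cV_ReIm_eq => k; have [XR XI] := XS k.
  rewrite [(_ + _ : V) _ _]mxE ReD ![(_ *: _ : V) _ _]mxE !ReZ !vderiv_Re.
  by apply: etrans (eq_tderiv _ _ _) (tderivM fS XR vp) => a; rewrite mxE ReZ.
rewrite [(_ + _ : V) _ _]mxE ImD ![(_ *: _ : V) _ _]mxE !ImZ !vderiv_Im.
by apply: etrans (eq_tderiv _ _ _) (tderivM fS XI vp) => a; rewrite mxE ImZ.
Qed.

Lemma vderiv_mulI X : vsmooth X -> vderiv (fun a => iC *: X a) p v = iC *: vderiv X p v.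
Proof.
move=> XS; apply: cV_ReIm_eq => k; have [XR XI] := XS k.
  rewrite [(_ *: _ : V) _ _]mxE Re_mulI vderiv_Re vderiv_Im.
  by apply: etrans (eq_tderiv _ _ _) (tderivN XI vp) => a; rewrite mxE Re_mulI.
rewrite [(_ *: _ : V) _ _]mxE Im_mulI vderiv_Re vderiv_Im.
by apply: eq_tderiv => a; rewrite mxE Im_mulI.
Qed.

Lemma vderiv_cst u : vderiv (fun=> u) p v = 0.
Proof.
by apply: cV_ReIm_eq => k; rewrite ?vderiv_Re ?vderiv_Im tderiv_cst mxE.
Qed.

Lemma vderiv_val : vderiv val p v = v.
Proof.
apply: cV_ReIm_eq => k; first by rewrite vderiv_Re; exact: tderiv_Re.
by rewrite vderiv_Im; exact: tderiv_Im.
Qed.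

Lemma vderivN X : vsmooth X -> vderiv (fun a => - X a) p v = - vderiv X p v.
Proof.
move=> XS; apply: cV_ReIm_eq => k; have [XR XI] := XS k.
  rewrite [(- _ : V) _ _]mxE ReN !vderiv_Re.
  by apply: etrans (eq_tderiv _ _ _) (tderivN XR vp) => a; rewrite mxE ReN.
rewrite [(- _ : V) _ _]mxE ImN !vderiv_Im.
by apply: etrans (eq_tderiv _ _ _) (tderivN XI vp) => a; rewrite mxE ImN.
Qed.

Lemma tderiv_rdot X Y : vsmooth X -> vsmooth Y ->
  tderiv (fun a => rdot (X a) (Y a)) p v =
  rdot (vderiv X p v) (Y p) + rdot (X p) (vderiv Y p v).
Proof.
move=> XS YS; rewrite tderiv_sum //; last first.
  move=> k; have [XR XI] := XS k; have [YR YI] := YS k.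
  by apply: sphere_smoothD; apply: sphere_smoothM.
rewrite -big_split; apply: eq_bigr => k _.
have [XR XI] := XS k; have [YR YI] := YS k.
rewrite tderivD ?tderivM ?mxE //=; try exact: sphere_smoothM.
by rewrite addrACA.
Qed.

Lemma vderivDv u Y : vsmooth Y -> rdot u (val p) = 0 ->
  vderiv Y p (v + u) = vderiv Y p v + vderiv Y p u.
Proof.
move=> YS up; apply: cV_ReIm_eq => k; have [YR YI] := YS k.
  apply: etrans (vderiv_Re _ _ _ _) (etrans _ (esym (ReDv _ _ _))).
  exact: etrans (tderivDv YR vp up) (esym (congr2 +%R (vderiv_Re _ _ _ _) (vderiv_Re _ _ _ _))).
apply: etrans (vderiv_Im _ _ _ _) (etrans _ (esym (ImDv _ _ _))).
exact: etrans (tderivDv YI vp up) (esym (congr2 +%R (vderiv_Im _ _ _ _) (vderiv_Im _ _ _ _))).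
Qed.

Lemma vderivZv (t : R) Y : vsmooth Y -> vderiv Y p (t%:C *: v) = t%:C *: vderiv Y p v.
Proof.
move=> YS; apply: cV_ReIm_eq => k; have [YR YI] := YS k.
  apply: etrans (vderiv_Re _ _ _ _) (etrans _ (esym (ReZv _ _ _))).
  exact: etrans (tderivZv _ YR vp) (esym (congr1 ( *%R t) (vderiv_Re _ _ _ _))).
apply: etrans (vderiv_Im _ _ _ _) (etrans _ (esym (ImZv _ _ _))).
exact: etrans (tderivZv _ YI vp) (esym (congr1 ( *%R t) (vderiv_Im _ _ _ _))).
Qed.

End VectorDerivative.

(* The tangential part of the ambient derivative: <D_X Y, p> = - <X, Y>. *)
Definition proj_conn : operator R n := fun X Y p =>
  vderiv Y p (X p) + (rdot (X p) (Y p))%:C *: val p.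

Lemma vfield_proj_conn X Y : vfield X -> vfield Y -> vfield (proj_conn X Y).
Proof.
move=> Xv Yv; have Xt p := vfield_tangent p Xv; have Yt p := vfield_tangent p Yv.
split=> [p|].
  (* Derivative along [X] of the tangency condition [rdot (Y a) (val a) = 0]. *)
  have := tderiv_rdot (Xt p) (vfield_smooth Yv) vsmooth_val.
  rewrite (_ : (fun a => _) = fun=> 0); last by apply/funext.
  rewrite tderiv_cst vderiv_val // rdotDl rdotZl rdot_sphere mulr1.
  by rewrite (rdotC (X p)) => <-.
apply: vsmoothD; last first.
  apply: vsmoothZ vsmooth_val.
  by apply: sphere_smooth_rdot; apply: vfield_smooth.
move=> k; have [YR YI] := vfield_smooth Yv k.
split; [have := sphere_smooth_app_vf Xv YR|have := sphere_smooth_app_vf Xv YI];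
  by congr sphere_smooth; apply/funext => p; rewrite mxE.
Qed.

Lemma proj_conn_affine : affine_connection proj_conn.
Proof.
split=> [X Y|X X' Y Xv X'v Yv p|f X Y fS Xv Yv p|X Y Y' Xv Yv Y'v p|f X Y fS Xv Yv p].
- exact: vfield_proj_conn.
- have YS := vfield_smooth Yv; have Xp := vfield_tangent p Xv.
  have X'p := vfield_tangent p X'v.
  by rewrite /proj_conn vderivDv // rdotDl scaleCD addrACA.
- have YS := vfield_smooth Yv; have Xp := vfield_tangent p Xv.
  by rewrite /proj_conn vderivZv // rdotZl scaleCM -scalerDr.
- have YS := vfield_smooth Yv; have Y'S := vfield_smooth Y'v.
  have Xp := vfield_tangent p Xv.
  by rewrite /proj_conn vderivD // rdotDr scaleCD addrACA.
- have YS := vfield_smooth Yv; have Xp := vfield_tangent p Xv.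
  by rewrite /proj_conn vderivZ // rdotZr scaleCM scalerDr addrA.
Qed.

(** The correction along [val p] is orthogonal to tangent fields, so the product rule for [rdot]
    gives metricity. It is symmetric in [X] and [Y], so it drops out of the torsion, and
    [lie_bracket] is by its coordinate definition the commutator [D_X Y - D_Y X]. *)
Lemma proj_conn_levi_civita : is_levi_civita proj_conn.
Proof.
split; first exact: proj_conn_affine.
  move=> X Y Z Xv Yv Zv p; rewrite /app_vf tderiv_rdot ?vfield_tangent //;
    try exact: vfield_smooth.
  rewrite rdotDl rdotDr rdotZl rdotZr [rdot (val p) _]rdotC !vfield_tangent //.
  by rewrite !mulr0 !addr0.
move=> X Y Xv Yv p; rewrite /torsion /proj_conn (rdotC (Y p)) opprD addrACA subrr addr0.
apply/eqP; rewrite subr_eq0; apply/eqP/cV_ReIm_eq => k;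
  by rewrite !mxE ?ReD ?ImD ?ReN ?ImN.
Qed.

(* The difference of two Levi-Civita connections is symmetric in its first two
   slots and skew in its last two, hence zero. *)
Lemma levi_civita_unique (N1 N2 : operator R n) X Y p :
  is_levi_civita N1 -> is_levi_civita N2 -> vfield X -> vfield Y -> N1 X Y p = N2 X Y p.
Proof.
move=> [A1 M1 T1] [A2 M2 T2] Xv Yv.
pose D U W a := N1 U W a - N2 U W a.
have Dv U W : vfield U -> vfield W -> vfield (D U W).
  by move=> Uv Wv; apply: vfieldB; apply: conn_vfield.
have swap (A B C E : V) : A - B = C - E -> A - C = B - E.
  move=> /eqP; rewrite subr_eq => /eqP ->.
  by rewrite [_ + B]addrC -addrA [_ - _ - _]addrAC subrr add0r.
have Dsym U W a : vfield U -> vfield W -> D U W a = D W U a.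
  move=> Uv Wv; have /eqP := T1 U W Uv Wv a; have /eqP := T2 U W Uv Wv a.
  rewrite /torsion !subr_eq0 => /eqP e2 /eqP e1.
  exact: swap (etrans e1 (esym e2)).
have Dskew U W Z a : vfield U -> vfield W -> vfield Z ->
    rdot (D U W a) (Z a) = - rdot (D U Z a) (W a).
  move=> Uv Wv Zv; have := M1 U W Z Uv Wv Zv a; rewrite (M2 U W Z Uv Wv Zv a).
  rewrite /D !rdotBl (rdotC (N1 U Z a)) (rdotC (N2 U Z a)).
  move: (rdot _ _) (rdot _ _) (rdot _ _) (rdot _ _) => r1 r2 r3 r4 e.
  lra.
have D0 U W Z a : vfield U -> vfield W -> vfield Z -> rdot (D U W a) (Z a) = 0.
  move=> Uv Wv Zv; apply/eqP; rewrite -[_ == 0](mulrn_eq0 _ 2) mulr2n addr_eq0.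
  (* With [d(U,W,Z)] for the value: [d(U,W,Z) = - d(U,Z,W) = - d(Z,U,W) = d(Z,W,U) = d(W,Z,U) = -
     d(W,U,Z) = - d(U,W,Z)]. *)
  by rewrite {1}Dskew // (Dsym U Z) // Dskew // opprK (Dsym Z W) // Dskew // (Dsym W U).
(* [D X Y] is itself a vector field and serves as third argument, so its norm vanishes. *)
have := D0 X Y _ p Xv Yv (Dv X Y Xv Yv) => /rdot_eq0 /eqP.
by rewrite subr_eq0 => /eqP.
Qed.

(** [proj_conn] shows that the choice in [levi_civita] is made from a nonempty set, and uniqueness
    transfers its formula to whichever connection was chosen. *)
Lemma levi_civitaE X Y p : vfield X -> vfield Y ->
  levi_civita X Y p = vderiv Y p (X p) + (rdot (X p) (Y p))%:C *: val p.
Proof.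
move=> Xv Yv; rewrite -[RHS]/(proj_conn X Y p).
apply: levi_civita_unique => //; last exact: proj_conn_levi_civita.
exact: (xgetPex _ (ex_intro _ _ proj_conn_levi_civita)).
Qed.

End LeviCivita.

(** * Tensoriality *)

Section DifferenceTensor.
Context {R : realType} {n : nat}.

Local Notation V := 'cV[R[i]]_n.+1.
Local Notation Re := complex.Re.
Local Notation Im := complex.Im.
Local Notation iC := (Complex (0 : R) 1).
Implicit Types (f : sphere R n -> R) (p : sphere R n) (u v w : V)
  (X Y Z : sphere R n -> V).

Lemma rdot_mulII u v : rdot (iC *: u) (iC *: v) = rdot u v.
Proof.
apply: eq_bigr => k _; rewrite !mxE.
by case: (u k 0) (v k 0) => a b [c d] /=; ring.
Qed.

Lemma rdot_mulIl u v : rdot (iC *: u) v = - rdot u (iC *: v).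
Proof.
rewrite -sumrN; apply: eq_bigr => k _; rewrite !mxE.
by case: (u k 0) (v k 0) => a b [c d] /=; ring.
Qed.

Lemma rdot_mulI_self u : rdot (iC *: u) u = 0.
Proof. by have := rdot_mulIl u u; rewrite rdotC; lra. Qed.

(** Orthogonal projection of a constant field. Being global, it extends a tangent vector to a vector
    field without cutoff functions, and such fields span every tangent space. *)
Definition tangent_field u : sphere R n -> V :=
  fun a => u - (rdot u (val a))%:C *: val a.

Lemma vfield_tangent_field u : vfield (tangent_field u).
Proof.
split=> [p|]; first by rewrite rdotBl rdotZl rdot_sphere mulr1 subrr.
apply: vsmoothD; first exact: vsmooth_cst.
apply: vsmoothN; apply: vsmoothZ vsmooth_val.
exact: sphere_smooth_rdot (vsmooth_cst u) vsmooth_val.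
Qed.

Lemma tangent_fieldD u v a :
  tangent_field (u + v) a = tangent_field u a + tangent_field v a.
Proof. by rewrite /tangent_field rdotDl scaleCD opprD addrACA. Qed.

Lemma tangent_fieldZ (t : R) u a :
  tangent_field (t%:C *: u) a = t%:C *: tangent_field u a.
Proof. by rewrite /tangent_field rdotZl scaleCM -scalerBr. Qed.

Lemma tangent_field_id p u : rdot u (val p) = 0 -> tangent_field u p = u.
Proof. by move=> up; rewrite /tangent_field up scaleC0 subr0. Qed.

Lemma tangent_field_normal p : tangent_field (val p) p = 0.
Proof. by rewrite /tangent_field rdot_sphere scaleC1 subrr. Qed.

Lemma sasaki_psi_tangent p v : rdot (sasaki_psi p v) (val p) = 0.
Proof. by rewrite /sasaki_psi rdotBl rdotZl rdot_sphere mulr1 subrr. Qed.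

Lemma vfield_psi Y : vfield Y -> vfield (fun a => sasaki_psi a (Y a)).
Proof.
move=> Yv; have YS := vsmooth_mulI (vfield_smooth Yv); split=> [p|].
  exact: sasaki_psi_tangent.
apply: vsmoothD => //; apply: vsmoothN; apply: vsmoothZ vsmooth_val.
exact: sphere_smooth_rdot YS vsmooth_val.
Qed.

(** The normal component of the ambient derivative cancels against the correction term. What remains
    is built from [rdot] and [val] only, so its equivariance under unitary matrices can be read
    off. *)
Lemma levi_civita_tangent_field u v p :
  levi_civita (tangent_field u) (tangent_field v) p =
  - ((rdot v (val p))%:C *: tangent_field u p).
Proof.
have uv := vfield_tangent_field u; have vv := vfield_tangent_field v.
rewrite levi_civitaE //; have up := vfield_tangent p uv.
have rS : sphere_smooth (fun a : sphere R n => rdot v (val a)).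
  exact: sphere_smooth_rdot (vsmooth_cst v) vsmooth_val.
have e : vderiv (tangent_field v) p (tangent_field u p) =
    - ((rdot v (tangent_field u p))%:C *: val p
       + (rdot v (val p))%:C *: tangent_field u p).
  have nS := vsmoothZ rS vsmooth_val.
  rewrite (vderivD up (vsmooth_cst v) (vsmoothN nS)) (vderivN up nS).
  rewrite (vderivZ up rS vsmooth_val) vderiv_cst (vderiv_val up).
  rewrite (tderiv_rdot up (vsmooth_cst v) vsmooth_val) vderiv_cst rdot0l !add0r.
  by rewrite (vderiv_val up).
have -> : rdot (tangent_field u p) (tangent_field v p) = rdot v (tangent_field u p).
  by rewrite {2}/tangent_field rdotBr rdotZr up mulr0 subr0 rdotC.
by rewrite e opprD addrAC addNr add0r.
Qed.

(** The Sasakian identity. Multiplication by [i] commutes with the ambient derivative, so all terms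
    containing [D_X Y] cancel; what survives comes from differentiating [val] in [sasaki_psi] and
    from the normal correction of the connection. *)
Lemma nabla_psi_levi_civita X Y p : vfield X -> vfield Y ->
  nabla_psi levi_civita X Y p =
  (rdot (X p) (Y p))%:C *: sasaki_xi p - (sasaki_eta p (Y p))%:C *: X p.
Proof.
move=> Xv Yv; have Xp := vfield_tangent p Xv; have Yp := vfield_tangent p Yv.
have YS := vfield_smooth Yv; have iYS := vsmooth_mulI YS.
have eS : sphere_smooth (fun a => sasaki_eta a (Y a)).
  exact: sphere_smooth_rdot iYS vsmooth_val.
rewrite /nabla_psi !levi_civitaE //; last exact: vfield_psi.
set D := vderiv Y p (X p).
have te : tderiv (fun a => sasaki_eta a (Y a)) p (X p) =
    rdot (iC *: D) (val p) + rdot (iC *: Y p) (X p).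
  apply: etrans (tderiv_rdot Xp iYS vsmooth_val) _.
  by rewrite (vderiv_mulI Xp YS) (vderiv_val Xp).
have e : vderiv (fun a => sasaki_psi a (Y a)) p (X p) =
    iC *: D - ((rdot (iC *: D) (val p) + rdot (iC *: Y p) (X p))%:C *: val p
               + (sasaki_eta p (Y p))%:C *: X p).
  have nS := vsmoothZ eS vsmooth_val.
  rewrite (vderivD Xp iYS (vsmoothN nS)) (vderivN Xp nS).
  by rewrite (vderivZ Xp eS vsmooth_val) (vderiv_mulI Xp YS) (vderiv_val Xp) te.
rewrite e /sasaki_psi /sasaki_xi /sasaki_eta !scalerDr !rdotDl !rdotDr !rdotNr.
rewrite !rdotZr (rdotC (X p) (val p)) [rdot (val p) _]rdotC Xp mulr0 oppr0 addr0.
rewrite scaleCAC rdotZl rdot_mulI_self mulr0 addr0 (rdotC (X p) (iC *: _)).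
move: (rdot (iC *: D) _) (rdot (iC *: Y p) (X p)) (rdot (iC *: Y p) (val p)) => r1 r2 r3.
rewrite !scaleCD !scaleNr !scalerN !opprD !opprK !addrA.
by clearbody D; apply/matrixP => k j; rewrite !mxE; ring.
Qed.

Lemma cV_real_basis u : u =
  \sum_k ((Re (u k 0))%:C *: delta_mx k 0 + (Im (u k 0))%:C *: (iC *: delta_mx k 0)).
Proof.
apply/matrixP => k j; rewrite ord1 summxE (bigD1 k) //= big1 => [|l lk].
  rewrite !mxE !eqxx /= !mulr1 addr0; case: (u k 0) => a b; simpc.
  by apply/eqP; rewrite eq_complex /=; apply/andP; split; apply/eqP; ring.
by rewrite !mxE eq_sym (negbTE lk) /= !mulr0 addr0.
Qed.

Lemma tangent_field_sum u a : tangent_field u a =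
  \sum_k ((Re (u k 0))%:C *: tangent_field (delta_mx k 0) a
          + (Im (u k 0))%:C *: tangent_field (iC *: delta_mx k 0) a).
Proof.
have t0 : tangent_field 0 a = 0 by rewrite /tangent_field rdot0l scaleC0 subrr.
rewrite {1}(cV_real_basis u) (big_morph (tangent_field ^~ a) (fun x y => tangent_fieldD x y a) t0).
by apply: eq_bigr => k _; rewrite tangent_fieldD !tangent_fieldZ.
Qed.

(* A map on vector fields that is additive and C^oo-homogeneous at p only
   depends on the value at p: expand a field X as the tangential projection of
   its coordinates. *)
Lemma tensorial_pointwise p (B : (sphere R n -> V) -> V) X :
  (forall X Y, vfield X -> vfield Y -> B (fun a => X a + Y a) = B X + B Y) ->
  (forall f X, sphere_smooth f -> vfield X ->
     B (fun a => (f a)%:C *: X a) = (f p)%:C *: B X) ->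
  vfield X -> B X = B (tangent_field (X p)).
Proof.
move=> BD BZ.
have B0 : B (fun=> 0) = 0.
  have := BZ (fun=> 0) _ (sphere_smooth_cst 0) vfield0.
  have -> : (fun=> (0 : R)%:C *: (0 : V)) = (fun=> 0) :> (sphere R n -> V).
    by apply/funext => a; rewrite scaler0.
  by rewrite scaleC0.
have Bsum (c d : 'I_n.+1 -> sphere R n -> R) (r : seq 'I_n.+1) :
    (forall k, sphere_smooth (c k)) -> (forall k, sphere_smooth (d k)) ->
    vfield (fun a => \sum_(k <- r) ((c k a)%:C *: tangent_field (delta_mx k 0) a
          + (d k a)%:C *: tangent_field (iC *: delta_mx k 0) a)) /\
    B (fun a => \sum_(k <- r) ((c k a)%:C *: tangent_field (delta_mx k 0) a
          + (d k a)%:C *: tangent_field (iC *: delta_mx k 0) a)) =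
    \sum_(k <- r) ((c k p)%:C *: B (tangent_field (delta_mx k 0))
          + (d k p)%:C *: B (tangent_field (iC *: delta_mx k 0))).
  move=> cS dS; elim: r => [|k r [IHv IH]].
    rewrite big_nil (_ : (fun a => _) = fun=> 0); last by apply/funext => a; rewrite big_nil.
    by split; [exact: vfield0|].
  set S := fun a => \sum_(k <- r) _ in IHv IH.
  pose C1 a := (c k a)%:C *: tangent_field (delta_mx k 0) a.
  pose C2 a := (d k a)%:C *: tangent_field (iC *: delta_mx k 0) a.
  have C1v : vfield C1 by apply: vfieldZ (cS k) (vfield_tangent_field _).
  have C2v : vfield C2 by apply: vfieldZ (dS k) (vfield_tangent_field _).
  rewrite (_ : (fun a => _) = fun a => (C1 a + C2 a) + S a); last first.
    by apply/funext => a; rewrite big_cons.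
  split; first by apply: vfieldD => //; apply: vfieldD.
  have b1 : B C1 = _ := BZ _ _ (cS k) (vfield_tangent_field _).
  have b2 : B C2 = _ := BZ _ _ (dS k) (vfield_tangent_field _).
  rewrite big_cons; apply: etrans (BD _ _ (vfieldD C1v C2v) IHv) _.
  congr (_ + _); last exact: IH.
  by apply: etrans (BD _ _ C1v C2v) _; congr (_ + _); [exact: b1|exact: b2].
move=> Xv; have XS := vfield_smooth Xv.
(* [Bsum] is used with the coordinate functions of [X] and with their values at [p] taken as
   constants; both give the same right-hand side. *)
have [_ e1] := Bsum _ _ (index_enum 'I_n.+1) (fun k => (XS k).1) (fun k => (XS k).2).
have [_ e2] := Bsum _ _ (index_enum 'I_n.+1) (fun k => sphere_smooth_cst (Re (X p k 0)))
  (fun k => sphere_smooth_cst (Im (X p k 0))).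
have XE : X = fun a => \sum_k ((Re (X a k 0))%:C *: tangent_field (delta_mx k 0) a
          + (Im (X a k 0))%:C *: tangent_field (iC *: delta_mx k 0) a).
  apply/funext => a; rewrite -tangent_field_sum tangent_field_id //.
  exact: vfield_tangent.
apply: etrans (congr1 B XE) (etrans e1 (etrans (esym e2) _)).
congr B; apply/funext => a; symmetry; exact: tangent_field_sum.
Qed.

End DifferenceTensor.

(** * The group SU(n+1) *)

Section SpecialUnitary.
Context {R : realType} {n : nat}.

Local Open Scope sesquilinear_scope.
Local Notation V := 'cV[R[i]]_n.+1.
Local Notation C := R[i].
Local Notation Re := complex.Re.
Local Notation Im := complex.Im.
Local Notation iC := (Complex (0 : R) 1).
Implicit Types (p : sphere R n) (u v w : V) (s : 'M[C]_n.+1).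

Lemma conj_iC : Num.conj (iC : C) = - iC.
Proof. by rewrite complexiE conjCi. Qed.

Lemma rdot_unitary s u v : s \is unitarymx -> rdot (s *m u) (s *m v) = rdot u v.
Proof.
move=> sU; rewrite !rdot_herm trmx_mul map_mxM mulmxA -[_ *m s]mulmxA.
have -> : s ^t* *m s = 1%:M by rewrite -invmx_unitary // mulVmx // unitarymx_unit.
by rewrite mulmx1.
Qed.

Lemma SU_diag (d : 'rV[C]_n.+1) : (forall k, d 0 k * Num.conj (d 0 k) = 1) ->
  \prod_k d 0 k = 1 -> SU (diag_mx d).
Proof.
move=> d1 dp; split; last by rewrite det_diag.
apply/unitarymxP; rewrite tr_diag_mx map_diag_mx mulmx_diag.
apply/matrixP => i j; rewrite !mxE d1.
by [].
Qed.

Lemma diag_mx_delta (d : 'rV[C]_n.+1) c k :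
  diag_mx d *m (c *: delta_mx k 0) = d 0 k *: (c *: delta_mx k 0) :> V.
Proof.
rewrite -scalemxAr scalerA mulrC -scalerA; congr (_ *: _).
apply/matrixP => a b; rewrite mul_diag_mx !mxE.
by case: (eqVneq a k) => [->|ak]; rewrite ?mulr0 //= ?andbF ?mulr0.
Qed.

(** A phase [x] at [j], with [y] at [k] available to restore determinant 1. *)
Definition two_phases (j k : 'I_n.+1) (x y : C) : 'rV[C]_n.+1 :=
  \row_l (if l == j then x else if l == k then y else 1).

Lemma SU_two_phases (j k : 'I_n.+1) x y : j != k -> x * Num.conj x = 1 -> x * y = 1 ->
  SU (diag_mx (two_phases j k x y)).
Proof.
move=> jk x1 xy.
have y1 : y * Num.conj y = 1.
  have x0 : x != 0 by apply: contra_eq_neq x1 => ->; rewrite mul0r eq_sym oner_eq0.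
  have -> : y = Num.conj x by apply: (mulfI x0); rewrite xy x1.
  by rewrite conjCK mulrC.
apply: SU_diag => [l|].
  by rewrite mxE; case: ifP => // _; case: ifP => // _; rewrite conjC1 mulr1.
rewrite (bigD1 j) //= (bigD1 k) 1?eq_sym //= big1 => [|l /andP[lj lk]].
  by rewrite !mxE !eqxx [k == j]eq_sym (negbTE jk) mulr1 xy.
by rewrite mxE (negbTE lj) (negbTE lk).
Qed.

(* s exchanges the coordinates j and k, with a sign on e_k to have det s = 1. *)
Lemma SU_exchange (j k : 'I_n.+1) : j != k -> exists s, SU s /\
  forall l, l != k -> s *m delta_mx l 0 = delta_mx (tperm j k l) 0 :> V.
Proof.
move=> jk; pose d : 'rV[C]_n.+1 := \row_l (if l == k then -1 else 1).
exists (perm_mx (tperm j k) *m diag_mx d); split.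
  split; last first.
    rewrite det_mulmx det_perm odd_tperm jk det_diag (bigD1 k) //= big1.
      by rewrite mxE eqxx mulr1 mulrNN mulr1.
    by move=> l lk; rewrite mxE (negbTE lk).
  apply: mul_unitarymx.
    by apply/unitarymxP; rewrite tr_perm_mx map_perm_mx -perm_mxM mulgV perm_mx1.
  apply/unitarymxP; rewrite tr_diag_mx map_diag_mx mulmx_diag.
  apply/matrixP => a b; rewrite !mxE.
  by case: (a == k); rewrite ?rmorphN1 ?rmorph1 ?mulrNN mulr1.
move=> l lk; have := diag_mx_delta d 1 l; rewrite scale1r => dl.
rewrite -mulmxA dl mxE (negbTE lk) scale1r -row_permE.
apply/matrixP => a b; rewrite !mxE; congr (_ && _)%:R.
exact: can2_eq (tpermK j k) (tpermK j k) _ _.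
Qed.

(** Gram-Schmidt completes [val p] to a unitary matrix with first column [val p]; a phase in the
    last column then makes the determinant 1. *)
Lemma SU_transitive p : (0 < n)%N ->
  exists s, SU s /\ s *m delta_mx 0 0 = val p.
Proof.
move=> n0; pose A : 'M[C]_n.+1 := \matrix_(i, j) (if i == 0 then val p j 0 else 0).
have SA : schmidt A \is unitarymx by apply: schmidt_unitarymx.
have rA : row 0 A = (val p)^T by apply/matrixP => i j; rewrite !mxE ord1.
set r0 := row 0 (schmidt A).
have [c cE] : exists c, row 0 A = c *: r0.
  have := row_schmidt_sub A 0; rewrite (big_pred1 0) => [|k]; last first.
    by rewrite /= leqn0.
  by rewrite genmxE => /sub_rVP.
have r01 : (r0 *m r0 ^t*) 0 0 = 1.
  have /unitarymxP /matrixP /(_ 0 0) := SA.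
  rewrite mxE [RHS]mxE => e; rewrite mxE; apply: etrans e.
  by apply: eq_bigr => k _; rewrite !mxE.
have p1 : (row 0 A *m (row 0 A) ^t*) 0 0 = 1.
  rewrite rA mxE; apply: etrans (congr1 (real_complex R) (rdot_sphere p)).
  rewrite rmorph_sum; apply: eq_bigr => k _; rewrite !mxE -normCK -add_Re2_Im2 !expr2.
  by [].
(* Gram-Schmidt makes the inner product of a row with its orthonormalized version nonnegative, so
   [c >= 0]; both rows are unit vectors, so [c] has modulus 1. *)
have c1 : c = 1.
  have := form1_row_schmidt A 0; rewrite -/r0 dotmxE cE -scalemxAl mxE r01 mulr1 => c_ge0.
  move: p1; rewrite cE linearZ /= map_mxZ -scalemxAl -scalemxAr scalerA mxE r01 mulr1 => cc.
  have : c * Num.conj c = 1 by exact: cc.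
  rewrite (geC0_conj c_ge0) -expr2 => /eqP; rewrite sqrf_eq1 => /orP[/eqP //|/eqP cN1].
  by move: c_ge0; rewrite cN1 oppr_ge0 ler10.
pose s0 := (schmidt A)^T.
have s0U : s0 \is unitarymx by rewrite trmx_unitary.
have s0e : s0 *m delta_mx 0 0 = val p.
  rewrite -colE -tr_row -/r0 -(scale1r r0) -c1 -cE rA trmxK.
  by [].
have ds : \det s0 * Num.conj (\det s0) = 1.
  have /unitarymxP /(congr1 determinant) := s0U.
  rewrite det_mulmx det_map_mx (det_tr s0) det1 => e; exact: e.
have d0 : \det s0 != 0.
  by apply: contra_eq_neq ds => ->; rewrite mul0r eq_sym oner_eq0.
have m0 : (ord_max : 'I_n.+1) != 0 by rewrite -val_eqE /= -lt0n.
(* The last column is not column 0 because [0 < n], so rescaling it keeps the image of [e_0]. *)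
pose d : 'rV[C]_n.+1 := \row_k (if k == ord_max then (\det s0)^-1 else 1).
exists (s0 *m diag_mx d); split.
  split; last first.
    rewrite det_mulmx det_diag (bigD1 ord_max) //= big1 => [|l lm].
      by rewrite mxE eqxx mulr1 divff.
    by rewrite mxE (negbTE lm).
  apply: (mul_unitarymx s0U); apply/unitarymxP; rewrite tr_diag_mx map_diag_mx mulmx_diag.
  apply/matrixP => a b; rewrite !mxE; case: (a == ord_max).
    by rewrite fmorphV -invfM ds invr1.
  by rewrite rmorph1 mulr1.
have := diag_mx_delta d 1 0; rewrite scale1r -mulmxA => ->.
by rewrite mxE eq_sym (negbTE m0) scale1r.
Qed.

End SpecialUnitary.

(** * Invariant trilinear forms *)

Section InvariantTrilinearForms.
Context {R : realType} {n : nat}.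

Local Notation V := 'cV[R[i]]_n.+1.
Local Notation C := R[i].
Local Notation Re := complex.Re.
Local Notation Im := complex.Im.
Local Notation iC := (Complex (0 : R) 1).
Implicit Types (u v w : V) (s : 'M[C]_n.+1).

(** [e_k] and [i e_k] together are a basis over the reals; the boolean lets one statement cover all
    combinations of the factors [1] and [i]. *)
Definition real_basis (c : bool) (k : 'I_n.+1) : V :=
  if c then iC *: delta_mx k 0 else delta_mx k 0.

Lemma real_linear_eq0 (f : V -> R) :
  (forall u v, f (u + v) = f u + f v) ->
  (forall (t : R) u, f (t%:C *: u) = t * f u) ->
  (forall c k, f (real_basis c k) = 0) -> forall u, f u = 0.
Proof.
move=> fD fZ f0 u; have f00 : f 0 = 0 by rewrite -(scale0r (0 : V)) fZ mul0r.
rewrite (cV_real_basis u) (big_morph f fD f00) big1 // => k _.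
by rewrite fD !fZ (f0 false k) (f0 true k) !mulr0 addr0.
Qed.

Lemma fresh_index (r : seq 'I_n.+1) : (size r <= n)%N -> exists y, y \notin r.
Proof.
move=> rn; apply/existsP; apply: contraT; rewrite negb_exists => /forallP r_all.
have : (n < n)%N; last by rewrite ltnn.
rewrite -[(_ < _)%N]/(n.+1 <= n)%N -[X in (X <= _)%N]card_ord.
apply: leq_trans rn; apply: leq_trans (card_size r).
by apply: subset_leq_card; apply/fintype.subsetP => y _; rewrite -[_ \in _]negbK r_all.
Qed.

Lemma mulmx_real_basis (d : 'rV[C]_n.+1) c k :
  diag_mx d *m real_basis c k = d 0 k *: real_basis c k.
Proof.
case: c => /=; first exact: diag_mx_delta.
by have := diag_mx_delta d 1 k; rewrite !scale1r.
Qed.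

Variable T : V -> V -> V -> R.
Hypotheses (TDl : forall u u' v w, T (u + u') v w = T u v w + T u' v w)
  (TZl : forall (t : R) u v w, T (t%:C *: u) v w = t * T u v w)
  (TDm : forall u v v' w, T u (v + v') w = T u v w + T u v' w)
  (TZm : forall (t : R) u v w, T u (t%:C *: v) w = t * T u v w)
  (Tskew : forall u v w, T u w v = - T u v w)
  (T0l : forall v w, T (delta_mx 0 0) v w = 0)
  (T0m : forall u w, T u (delta_mx 0 0) w = 0)
  (Tinv : forall s, SU s -> s *m delta_mx 0 0 = delta_mx 0 0 :> V ->
     forall u v w, T (s *m u) (s *m v) (s *m w) = T u v w).

Let TDr u v w w' : T u v (w + w') = T u v w + T u v w'.
Proof. by rewrite Tskew TDm opprD -!Tskew. Qed.

Let TZr (t : R) u v w : T u v (t%:C *: w) = t * T u v w.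
Proof. by rewrite Tskew TZm -mulrN -Tskew. Qed.

Let TNl u v w : T (- u) v w = - T u v w.
Proof. by rewrite -mulN1r -TZl scaleCN scaleC1. Qed.

Let TNm u v w : T u (- v) w = - T u v w.
Proof. by rewrite -mulN1r -TZm scaleCN scaleC1. Qed.

Let TNr u v w : T u v (- w) = - T u v w.
Proof. by rewrite -mulN1r -TZr scaleCN scaleC1. Qed.

Let T0r u v : T u v (delta_mx 0 0) = 0.
Proof. by rewrite Tskew T0m oppr0. Qed.

Let Tself u v : T u v v = 0.
Proof. by have := Tskew u v v; lra. Qed.

Lemma stabilizer_fix (j k : 'I_n.+1) (x y : C) : j != 0 -> k != 0 ->
  diag_mx (two_phases j k x y) *m delta_mx 0 0 = delta_mx 0 0 :> V.
Proof.
move=> j0 k0; have := mulmx_real_basis (two_phases j k x y) false 0 => /= ->.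
by rewrite mxE !(eq_sym 0) (negbTE j0) (negbTE k0) scale1r.
Qed.

Hypothesis n_ge4 : (4 <= n)%N.

(* Changing the signs of the coordinates x and y shows that the multiplicities
   of x and y have the same parity. *)
Lemma trilinear_odd_eq0 c d f (j k l x : 'I_n.+1) : x != 0 ->
  odd ((j == x) + (k == x) + (l == x)) ->
  T (real_basis c j) (real_basis d k) (real_basis f l) = 0.
Proof.
move=> x0 odd_x.
(* At most four of the at least five indices are excluded. The sign on [y] only restores the
   determinant: it changes neither [e_0] nor any of the three arguments. *)
have [y] := @fresh_index [:: 0; j; k; l] n_ge4.
rewrite !inE !negb_or => /and4P[y0 yj yk yl].
have [xy|xy] := eqVneq x y.
  move: odd_x; rewrite xy (eq_sym j) (eq_sym k) (eq_sym l).
  by rewrite (negbTE yj) (negbTE yk) (negbTE yl).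
have sS : SU (diag_mx (two_phases x y (-1 : C) (-1))).
  by apply: SU_two_phases => //; rewrite ?rmorphN1 mulrNN mulr1.
have := Tinv sS (stabilizer_fix _ _ x0 y0) (real_basis c j) (real_basis d k) (real_basis f l).
rewrite !mulmx_real_basis !mxE ![_ == y]eq_sym (negbTE yj) (negbTE yk) (negbTE yl).
move: odd_x; case: (j == x); case: (k == x); case: (l == x) => //= _;
  by rewrite ?scale1r ?scaleN1r ?TNl ?TNm ?TNr; lra.
Qed.

Variable j0 : 'I_n.+1.
Hypotheses (j0N0 : j0 != 0)
  (T110 : T (delta_mx j0 0) (delta_mx j0 0) (iC *: delta_mx 0 0) = 0)
  (T1i0 : T (delta_mx j0 0) (iC *: delta_mx j0 0) (iC *: delta_mx 0 0) = 0)
  (T01i : T (iC *: delta_mx 0 0) (delta_mx j0 0) (iC *: delta_mx j0 0) = 0).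

(** The phase [i] turns the plane of [e_j0] and [i e_j0] by a right angle and is compensated by
    [- i] on a further index, so [i e_0] stays fixed. This relates the values on [(e, e)] and
    [(i e, i e)], and those on [(e, i e)] and [(i e, e)]. *)
Let rotation : exists s, [/\ SU s, s *m delta_mx 0 0 = delta_mx 0 0 :> V,
  s *m delta_mx j0 0 = iC *: delta_mx j0 0 :> V,
  s *m (iC *: delta_mx j0 0) = - delta_mx j0 0 :> V &
  s *m (iC *: delta_mx 0 0) = iC *: delta_mx 0 0 :> V].
Proof.
have [k] := @fresh_index [:: 0; j0] (ltnW (ltnW n_ge4)).
rewrite !inE !negb_or => /andP[k0 kj].
exists (diag_mx (two_phases j0 k iC (- iC))).
have ii : (iC : C) * iC = -1 by rewrite -expr2 sqr_i.
have e0 := stabilizer_fix iC (- iC) j0N0 k0.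
have e1 : diag_mx (two_phases j0 k iC (- iC)) *m delta_mx j0 0 = iC *: delta_mx j0 0 :> V.
  by have := mulmx_real_basis (two_phases j0 k iC (- iC)) false j0 => /= ->; rewrite mxE eqxx.
split=> //; first by apply: SU_two_phases; rewrite 1?eq_sym ?conj_iC ?mulrN ?ii ?opprK.
  by rewrite -scalemxAr e1 scalerA ii scaleN1r.
by rewrite -scalemxAr e0.
Qed.

Lemma trilinear_same_same_0 c d :
  T (real_basis c j0) (real_basis d j0) (iC *: delta_mx 0 0) = 0.
Proof.
have [s [sS s0 s1 s2 s3]] := rotation.
case: c d => [] [] //=.
  by have := Tinv sS s0 (delta_mx j0 0) (delta_mx j0 0) (iC *: delta_mx 0 0); rewrite s1 s3 => ->.
have := Tinv sS s0 (delta_mx j0 0) (iC *: delta_mx j0 0) (iC *: delta_mx 0 0).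
by rewrite s1 s2 s3 T1i0 TNm => /eqP; rewrite oppr_eq0 => /eqP.
Qed.

Lemma trilinear_0_same_same d f :
  T (iC *: delta_mx 0 0) (real_basis d j0) (real_basis f j0) = 0.
Proof.
by case: d f => [] [] //=; rewrite ?Tself // Tskew T01i oppr0.
Qed.

(** The sign that [SU_exchange] puts on [e_j] does no harm, since only the images of [e_0], [e_j0]
    and [i e_j0] are used. *)
Lemma stabilizer_exchange (j : 'I_n.+1) : j != 0 -> exists s, [/\ SU s,
  s *m delta_mx 0 0 = delta_mx 0 0 :> V & forall c, s *m real_basis c j0 = real_basis c j].
Proof.
move=> jN0; have [->|jj] := eqVneq j j0.
  by exists 1%:M; split=> [||c]; rewrite ?mul1mx //; split; [by apply/unitarymxP; rewrite trmx1 map_mx1 mulmx1|exact: det1].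
have j0j : j0 != j by rewrite eq_sym.
have [s [sS sE]] := @SU_exchange R n _ _ j0j.
have e1 : s *m delta_mx j0 0 = delta_mx j 0 :> V by rewrite sE // tpermL.
exists s; split=> [//||[]] /=.
- by rewrite sE 1?eq_sym // tpermD.
- by rewrite -scalemxAr e1.
- exact: e1.
Qed.

(** An index 0 contributes only through [i e_0], as [e_0] kills every slot, and three indices 0 give
    zero by skewness. Skewness also exchanges [(j, j, 0)] and [(j, 0, j)], and [stabilizer_exchange]
    moves [j] to [j0], where the three test values are assumed to vanish. *)
Lemma invariant_trilinear_eq0 u v w : T u v w = 0.
Proof.
apply: (real_linear_eq0 (f := fun u => T u v w)) => // c j {u}.
apply: (real_linear_eq0 (f := fun v => T _ v w)) => // d k {v}.
apply: (real_linear_eq0 (f := fun w => T _ _ w)) => // f l {w}.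
have [j_0|jN0] := eqVneq j 0; last first.
  have [kj|kNj] := eqVneq k j.
    have [lj|lNj] := eqVneq l j.
      by apply: (trilinear_odd_eq0 _ _ _ jN0); rewrite kj lj eqxx.
    have [l0|lN0] := eqVneq l 0; last first.
      by apply: (trilinear_odd_eq0 _ _ _ lN0); rewrite kj ![j == l]eq_sym (negbTE lNj) eqxx.
    rewrite kj l0; case: f => /=; last exact: T0r.
    have [s [sS s0 sE]] := stabilizer_exchange jN0.
    by rewrite -!sE -s0 scalemxAr Tinv // trilinear_same_same_0.
  have [lj|lNj] := eqVneq l j; last first.
    by apply: (trilinear_odd_eq0 _ _ _ jN0); rewrite (negbTE kNj) (negbTE lNj) eqxx.
  have [k0|kN0] := eqVneq k 0; last first.
    by apply: (trilinear_odd_eq0 _ _ _ kN0); rewrite lj ![j == k]eq_sym (negbTE kNj) eqxx.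
  rewrite lj k0; case: d => /=; last exact: T0m.
  have [s [sS s0 sE]] := stabilizer_exchange jN0.
  by rewrite Tskew -!sE -s0 scalemxAr Tinv // trilinear_same_same_0 oppr0.
rewrite j_0; case: c => /=; last exact: T0l.
have [k0|kN0] := eqVneq k 0.
  have [l0|lN0] := eqVneq l 0.
    by rewrite k0 l0; case: d f => [] [] //=.
  by apply: (trilinear_odd_eq0 true _ _ lN0); rewrite k0 eq_sym (negbTE lN0) eqxx.
have [lk|lNk] := eqVneq l k; last first.
  by apply: (trilinear_odd_eq0 true _ _ kN0); rewrite eq_sym (negbTE kN0) (negbTE lNk) eqxx.
rewrite lk; have [s [sS s0 sE]] := stabilizer_exchange kN0.
by rewrite -!sE -s0 scalemxAr Tinv // trilinear_0_same_same.
Qed.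

End InvariantTrilinearForms.

(** * The difference tensor *)

Section InvariantConnections.
Context {R : realType} {n : nat}.

Local Notation V := 'cV[R[i]]_n.+1.
Local Notation C := R[i].
Local Notation iC := (Complex (0 : R) 1).
Implicit Types (p q : sphere R n) (u v w x y z : V) (s : 'M[C]_n.+1)
  (X Y Z : sphere R n -> V).

Lemma levi_civita_is_levi_civita : is_levi_civita (levi_civita : operator R n).
Proof. exact: (xgetPex _ (ex_intro _ _ proj_conn_levi_civita)). Qed.

(* The second summand is (nabla^g_u psi) v, see nabla_psi_levi_civita. *)
Definition sasaki_tensor (a b c : R) p u v : V :=
  a%:C *: ((sasaki_Phi p u v)%:C *: sasaki_xi p + (sasaki_eta p v)%:C *: sasaki_psi p u)
  + b%:C *: ((rdot u v)%:C *: sasaki_xi p - (sasaki_eta p v)%:C *: u)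
  + (c * sasaki_eta p u)%:C *: sasaki_psi p v.

(** The trilinear form of [sasaki_tensor] with psi replaced by multiplication by [i]: the two differ
    by a normal vector, which pairing with tangent vectors does not see. In this shape skewness in
    [y] and [z] is visible. *)
Definition sasaki_form (a b c : R) p x y z : R :=
  a * (rdot x (iC *: y) * sasaki_eta p z - sasaki_eta p y * rdot x (iC *: z))
  + b * (rdot x y * sasaki_eta p z - sasaki_eta p y * rdot x z)
  - c * (sasaki_eta p x * rdot y (iC *: z)).

Lemma rdot_sasaki_tensor a b c p x y z : rdot x (val p) = 0 -> rdot z (val p) = 0 ->
  rdot (sasaki_tensor a b c p x y) z = sasaki_form a b c p x y z.
Proof.
move=> xp zp; rewrite /sasaki_tensor /sasaki_form.
have xi_z : rdot (sasaki_xi p) z = sasaki_eta p z.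
  by rewrite /sasaki_xi scaleNr rdotNl rdot_mulIl opprK rdotC.
have psi_z t : rdot (sasaki_psi p t) z = - rdot t (iC *: z).
  by rewrite /sasaki_psi rdotBl rdotZl (rdotC (val p)) zp mulr0 subr0 rdot_mulIl.
have phi t : sasaki_Phi p x t = rdot x (iC *: t).
  by rewrite /sasaki_Phi /sasaki_psi rdotBr rdotZr xp mulr0 subr0.
rewrite phi; move: (sasaki_xi p) (sasaki_psi p x) (sasaki_psi p y) xi_z (psi_z x) (psi_z y).
move=> xi px py xi_z' px_z py_z.
by rewrite !(rdotDl, rdotZl, rdotNl) px_z py_z xi_z'; ring.
Qed.

Lemma sasaki_tensor_tangent a b c p x y : rdot x (val p) = 0 ->
  rdot (sasaki_tensor a b c p x y) (val p) = 0.
Proof.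
move=> xp; rewrite /sasaki_tensor.
have xi0 : rdot (sasaki_xi p) (val p) = 0.
  by rewrite /sasaki_xi scaleNr rdotNl rdot_mulI_self oppr0.
have psi0 t := sasaki_psi_tangent p t.
move: (sasaki_xi p) (sasaki_psi p x) (sasaki_psi p y) xi0 (psi0 x) (psi0 y).
move=> xi px py xi0 px0 py0.
by rewrite !(rdotDl, rdotZl, rdotNl) px0 py0 xi0 xp; ring.
Qed.

(** * Equivariance of the Sasakian structure under unitary matrices *)

Section Transport.
Variables (s : 'M[C]_n.+1) (p q : sphere R n).
Hypotheses (sU : s \is unitarymx) (pq : val q = s *m val p).

Lemma sasaki_xi_act : sasaki_xi q = s *m sasaki_xi p.
Proof. by rewrite /sasaki_xi pq scalemxAr. Qed.

Lemma sasaki_eta_act u : sasaki_eta q (s *m u) = sasaki_eta p u.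
Proof. by rewrite /sasaki_eta pq scalemxAr rdot_unitary. Qed.

Lemma sasaki_psi_act u : sasaki_psi q (s *m u) = s *m sasaki_psi p u.
Proof. by rewrite /sasaki_psi sasaki_eta_act mulmxBr pq !scalemxAr. Qed.

Lemma sasaki_tensor_act a b c u v :
  sasaki_tensor a b c q (s *m u) (s *m v) = s *m sasaki_tensor a b c p u v.
Proof.
have distr (k1 k2 k3 k4 k5 k6 k7 : C) (x1 x2 x3 x4 : V) :
    k1 *: (k2 *: (s *m x1) + k3 *: (s *m x2))
      + k4 *: (k5 *: (s *m x1) - k6 *: (s *m x3)) + k7 *: (s *m x4) =
    s *m (k1 *: (k2 *: x1 + k3 *: x2) + k4 *: (k5 *: x1 - k6 *: x3) + k7 *: x4).
  by rewrite !scalemxAr -!mulmxDr !scalemxAr -mulmxBr !scalemxAr -!mulmxDr.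
rewrite /sasaki_tensor /sasaki_Phi !sasaki_psi_act !sasaki_eta_act sasaki_xi_act.
by rewrite !(rdot_unitary _ _ sU) distr.
Qed.

Lemma tangent_field_act u : tangent_field (s *m u) q = s *m tangent_field u p.
Proof. by rewrite /tangent_field pq rdot_unitary // mulmxBr scalemxAr. Qed.

End Transport.

Lemma push_tangent_field s u : s \is unitarymx ->
  push s (tangent_field u) = tangent_field (s *m u).
Proof.
move=> sU; apply/funext => q; rewrite /push.
rewrite (tangent_field_act (q := q) (p := sphere_act (invmx s) q)) //.
by rewrite (val_sphere_act q sU).2 mulKVmx // unitarymx_unit.
Qed.

Lemma rdot_tangent_field p x u : rdot x (val p) = 0 ->
  rdot x (tangent_field u p) = rdot x u.
Proof. by move=> xp; rewrite /tangent_field rdotBr rdotZr xp mulr0 subr0. Qed.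

Variable nabla : operator R n.
Hypotheses (nabla_conn : affine_connection nabla)
  (nabla_metric : metric_connection nabla) (nabla_inv : SU_invariant nabla).

Let D : operator R n := fun X Y p => nabla X Y p - levi_civita X Y p.

Let lc_conn : affine_connection (levi_civita : operator R n).
Proof. by have [] := levi_civita_is_levi_civita. Qed.

Lemma diff_conn_vfield X Y : vfield X -> vfield Y -> vfield (D X Y).
Proof. by move=> Xv Yv; apply: vfieldB; apply: conn_vfield. Qed.

(** Both connections are metric, so the terms [X (g(Y, Z))] cancel in the difference. *)
Lemma diff_conn_skew X Y Z p : vfield X -> vfield Y -> vfield Z ->
  rdot (D X Y p) (Z p) = - rdot (D X Z p) (Y p).
Proof.
move=> Xv Yv Zv; have [_ lc_metric _] := levi_civita_is_levi_civita.
have := nabla_metric Xv Yv Zv p; rewrite (lc_metric X Y Z Xv Yv Zv p).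
rewrite /D !rdotBl (rdotC (Y p) (nabla X Z p)) (rdotC (Y p) (levi_civita X Z p)).
move: (rdot _ _) (rdot _ _) (rdot _ _) (rdot _ _) => r1 r2 r3 r4 e.
by lra.
Qed.

Let DDl X X' Y p : vfield X -> vfield X' -> vfield Y ->
  D (fun a => X a + X' a) Y p = D X Y p + D X' Y p.
Proof. by move=> *; rewrite /D (conn_addl nabla_conn) // (conn_addl lc_conn) // opprD addrACA. Qed.

Let DDr X Y Y' p : vfield X -> vfield Y -> vfield Y' ->
  D X (fun a => Y a + Y' a) p = D X Y p + D X Y' p.
Proof. by move=> *; rewrite /D (conn_addr nabla_conn) // (conn_addr lc_conn) // opprD addrACA. Qed.

Let DZl f X Y p : sphere_smooth f -> vfield X -> vfield Y ->
  D (fun a => (f a)%:C *: X a) Y p = (f p)%:C *: D X Y p.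
Proof. by move=> *; rewrite /D (conn_scalel nabla_conn) // (conn_scalel lc_conn) // scalerBr. Qed.

(** The derivative terms of the two Leibniz rules cancel, which makes [D] tensorial in its second
    argument. *)
Let DZr f X Y p : sphere_smooth f -> vfield X -> vfield Y ->
  D X (fun a => (f a)%:C *: Y a) p = (f p)%:C *: D X Y p.
Proof. by move=> *; rewrite /D (conn_leibniz nabla_conn) // (conn_leibniz lc_conn) // opprD addrACA subrr add0r scalerBr. Qed.

(** Projected constant fields define [T p] on all of C^{n+1} with [val p] in its kernel, so that a
    form on one fixed vector space replaces forms on tangent spaces. *)
Let T p u v : V := D (tangent_field u) (tangent_field v) p.

Let tfv u : vfield (tangent_field u : sphere R n -> V).
Proof. exact: vfield_tangent_field. Qed.

Lemma diff_conn_pointwise X Y p : vfield X -> vfield Y -> D X Y p = T p (X p) (Y p).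
Proof.
move=> Xv Yv.
rewrite (@tensorial_pointwise _ _ p (fun U => D U Y p) X) //; first last.
- by move=> f U fS Uv; apply: DZl.
- by move=> U U' Uv U'v; apply: DDl.
rewrite (@tensorial_pointwise _ _ p (fun U => D (tangent_field (X p)) U p) Y) //.
- by move=> U U' Uv U'v; apply: DDr.
- by move=> f U fS Uv; apply: DZr.
Qed.

Let tfD u v : tangent_field (u + v) =
  fun a : sphere R n => tangent_field u a + tangent_field v a.
Proof. by apply/funext => a; exact: tangent_fieldD. Qed.

Let tfZ (t : R) u : tangent_field (t%:C *: u) =
  fun a : sphere R n => t%:C *: tangent_field u a.
Proof. by apply/funext => a; exact: tangent_fieldZ. Qed.

Let TDl p u u' v : T p (u + u') v = T p u v + T p u' v.
Proof. by rewrite /T tfD DDl. Qed.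

Let TDr p u v v' : T p u (v + v') = T p u v + T p u v'.
Proof. by rewrite /T tfD DDr. Qed.

Let TZl p (t : R) u v : T p (t%:C *: u) v = t%:C *: T p u v.
Proof. by rewrite /T tfZ (DZl _ (sphere_smooth_cst t)). Qed.

Let TZr p (t : R) u v : T p u (t%:C *: v) = t%:C *: T p u v.
Proof. by rewrite /T tfZ (DZr _ (sphere_smooth_cst t)). Qed.

Let T_tangent p u v : rdot (T p u v) (val p) = 0.
Proof. by apply: vfield_tangent; apply: diff_conn_vfield. Qed.

Let T_skew p u v w : rdot (T p u w) v = - rdot (T p u v) w.
Proof.
have e : rdot (T p u w) (tangent_field v p) = - rdot (T p u v) (tangent_field w p).
  exact: diff_conn_skew p (tfv u) (tfv w) (tfv v).
apply: etrans (esym (rdot_tangent_field v (T_tangent p u w))) (etrans e _).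
congr (- _); exact: (rdot_tangent_field w (T_tangent p u v)).
Qed.

Let T0l p v : T p (val p) v = 0.
Proof.
apply: etrans (diff_conn_pointwise p (tfv _) (tfv _)) _.
by rewrite tangent_field_normal; have := TZl p 0 0 (tangent_field v p); rewrite !scaleC0.
Qed.

(** [push s] maps projected constant fields to projected constant fields, so the invariance of
    [nabla] becomes an identity between values at [p] and [q]; the Levi-Civita part follows from its
    explicit value on these fields. *)
Let T_act s p q u v : SU s -> val q = s *m val p ->
  T q (s *m u) (s *m v) = s *m T p u v.
Proof.
move=> sS pq; have sU := sS.1.
have pE : sphere_act (invmx s) q = p.
  by apply: val_inj; rewrite (val_sphere_act q sU).2 pq mulKmx // unitarymx_unit.
have e : s *m nabla (tangent_field u) (tangent_field v) p =
    nabla (tangent_field (s *m u)) (tangent_field (s *m v)) q.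
  have := nabla_inv sS (tfv u) (tfv v) q.
  by rewrite {1}/push pE (push_tangent_field u sU) (push_tangent_field v sU).
have e' : s *m levi_civita (tangent_field u) (tangent_field v) p =
    levi_civita (tangent_field (s *m u)) (tangent_field (s *m v)) q.
  apply: etrans (congr1 (mulmx s) (levi_civita_tangent_field u v p)) _.
  rewrite levi_civita_tangent_field (tangent_field_act sU pq) pq (rdot_unitary _ _ sU).
  by rewrite mulmxN scalemxAr.
by rewrite [RHS]mulmxBr e e'.
Qed.

Lemma difference_tensor : exists T : sphere R n -> V -> V -> V,
  [/\ forall X Y p, vfield X -> vfield Y ->
        nabla X Y p = levi_civita X Y p + T p (X p) (Y p),
      [/\ forall p u u' v, T p (u + u') v = T p u v + T p u' v,
          forall p (t : R) u v, T p (t%:C *: u) v = t%:C *: T p u v,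
          forall p u v v', T p u (v + v') = T p u v + T p u v',
          forall p (t : R) u v, T p u (t%:C *: v) = t%:C *: T p u v &
          forall p v, T p (val p) v = 0],
      forall p u v, rdot (T p u v) (val p) = 0,
      forall p u v w, rdot (T p u w) v = - rdot (T p u v) w &
      forall s p q u v, SU s -> val q = s *m val p ->
        T q (s *m u) (s *m v) = s *m T p u v].
Proof.
exists T; split=> //.
by move=> X Y p Xv Yv; rewrite -(diff_conn_pointwise p Xv Yv) /D addrC subrK.
Qed.

End InvariantConnections.

(** * Classification *)

Section Classification.
Context {R : realType} {n : nat}.

Local Notation V := 'cV[R[i]]_n.+1.
Local Notation C := R[i].
Local Notation iC := (Complex (0 : R) 1).
Implicit Types (p q : sphere R n) (u v w x y z : V) (s : 'M[C]_n.+1)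
  (X Y Z : sphere R n -> V).

Lemma mulII u : iC *: (iC *: u) = - u.
Proof. by rewrite scalerA -expr2 sqr_i scaleN1r. Qed.

Lemma rdot_mulIC u v : rdot v (iC *: u) = - rdot u (iC *: v).
Proof. by rewrite rdotC rdot_mulIl. Qed.

Lemma sasaki_etaD p u v : sasaki_eta p (u + v) = sasaki_eta p u + sasaki_eta p v.
Proof. by rewrite /sasaki_eta scalerDr rdotDl. Qed.

Lemma sasaki_etaZ p (t : R) u : sasaki_eta p (t%:C *: u) = t * sasaki_eta p u.
Proof. by rewrite /sasaki_eta scaleCAC rdotZl. Qed.

Lemma sasaki_formDl (a b c : R) p x x' y z : sasaki_form a b c p (x + x') y z =
  sasaki_form a b c p x y z + sasaki_form a b c p x' y z.
Proof. by rewrite /sasaki_form sasaki_etaD !rdotDl; ring. Qed.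

Lemma sasaki_formZl (a b c : R) p (t : R) x y z :
  sasaki_form a b c p (t%:C *: x) y z = t * sasaki_form a b c p x y z.
Proof. by rewrite /sasaki_form sasaki_etaZ !rdotZl; ring. Qed.

Lemma sasaki_formDm (a b c : R) p x y y' z : sasaki_form a b c p x (y + y') z =
  sasaki_form a b c p x y z + sasaki_form a b c p x y' z.
Proof. by rewrite /sasaki_form sasaki_etaD scalerDr rdotDl !rdotDr; ring. Qed.

Lemma sasaki_formZm (a b c : R) p (t : R) x y z :
  sasaki_form a b c p x (t%:C *: y) z = t * sasaki_form a b c p x y z.
Proof. by rewrite /sasaki_form sasaki_etaZ scaleCAC rdotZl !rdotZr; ring. Qed.

Lemma sasaki_form_skew (a b c : R) p x y z :
  sasaki_form a b c p x z y = - sasaki_form a b c p x y z.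
Proof. by rewrite /sasaki_form (rdot_mulIC y z); ring. Qed.

Lemma sasaki_form0l (a b c : R) p y z : sasaki_form a b c p 0 y z = 0.
Proof. by have := sasaki_formZl a b c p 0 0 y z; rewrite scaleC0 mul0r. Qed.

Lemma sasaki_form0m (a b c : R) p x z : sasaki_form a b c p x 0 z = 0.
Proof. by have := sasaki_formZm a b c p 0 x 0 z; rewrite scaleC0 mul0r. Qed.

Lemma sasaki_form_act (a b c : R) s p x y z : s \is unitarymx -> s *m val p = val p ->
  sasaki_form a b c p (s *m x) (s *m y) (s *m z) = sasaki_form a b c p x y z.
Proof.
move=> sU sp; have pp : val p = s *m val p by [].
by rewrite /sasaki_form !scalemxAr !(rdot_unitary _ _ sU) !(sasaki_eta_act sU pp).
Qed.

Lemma rdot_delta u k : rdot u (delta_mx k 0) = complex.Re (u k 0).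
Proof.
rewrite /rdot (bigD1 k) //= big1 => [|l lk]; rewrite !mxE ?eqxx /=.
  by rewrite mulr1 mulr0 !addr0.
by rewrite (negbTE lk) /= !mulr0 addr0.
Qed.

Section Basepoint.
Variables (p0 : sphere R n) (j : 'I_n.+1).
Hypotheses (p0E : val p0 = delta_mx 0 0) (j0 : j != 0).
Let e : V := delta_mx j 0.
Let ie : V := iC *: delta_mx j 0.
Let ie0 : V := iC *: delta_mx 0 0.

Lemma basepoint_tangent :
  [/\ rdot e (val p0) = 0, rdot ie (val p0) = 0 & rdot ie0 (val p0) = 0].
Proof.
rewrite p0E !rdot_delta /e /ie /ie0 !mxE !(eq_sym 0) (negbTE j0).
by rewrite !eqxx /= !(mulr0, mul0r) subrr.
Qed.

(** The first three values determine [b], [a] and [c]; the last two enter when the torsion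
    antisymmetrizes the form in its first two arguments. *)
Lemma basepoint_form (a b c : R) :
  [/\ sasaki_form a b c p0 e e ie0 = - b, sasaki_form a b c p0 e ie ie0 = a,
      sasaki_form a b c p0 ie0 e ie = - c, sasaki_form a b c p0 ie e ie0 = - a &
      sasaki_form a b c p0 ie0 e e = 0].
Proof.
have [te tie tie0] := basepoint_tangent.
have eta_e : sasaki_eta p0 e = 0 by exact: tie.
have eta_ie : sasaki_eta p0 ie = 0 by rewrite /sasaki_eta mulII rdotNl te oppr0.
(* [ie0] is [- sasaki_xi p0], hence the value -1. *)
have eta_ie0 : sasaki_eta p0 ie0 = -1.
  by rewrite /sasaki_eta mulII rdotNl -p0E rdot_sphere.
have ee : rdot e e = 1 by rewrite /e rdot_delta mxE !eqxx.
have eie : rdot e (iC *: e) = 0 by rewrite rdotC rdot_mulI_self.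
have ie0e : rdot ie0 e = 0.
  by rewrite /e rdot_delta !mxE (negbTE j0) /= !mulr0 subrr.
have ie0ie : rdot ie0 (iC *: e) = 0.
  by rewrite /ie0 rdot_mulII rdot_delta mxE (negbTE j0).
have ieiie : rdot e (iC *: ie) = -1 by rewrite mulII rdotNr ee.
have ieie : rdot ie (iC *: e) = 1 by rewrite /ie rdot_mulII ee.
have eie' : rdot e ie = 0 by [].
have iee : rdot ie e = 0 by rewrite rdotC.
move: e ie ie0 eta_e eta_ie eta_ie0 ee eie ie0e ie0ie ieiie ieie eie' iee {te tie tie0}.
move=> x y z e1 e2 e3 e4 e5 e6 e7 e8 e9 e10 e11; rewrite /sasaki_form e1 e2 e3.
by rewrite e4 e5 e6 e7 e8 e9 e10 e11; split; ring.
Qed.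

End Basepoint.

Lemma basepoint_exists : exists p0 : sphere R n, val p0 = delta_mx 0 0.
Proof.
have e1 : rdot (delta_mx 0 0 : V) (delta_mx 0 0) == 1.
  by rewrite rdot_delta mxE !eqxx.
by exists (exist (fun z : V => rdot z z == 1) _ e1).
Qed.

Lemma tensor_classification (T : sphere R n -> V -> V -> V) : (4 <= n)%N ->
  (forall p u u' v, T p (u + u') v = T p u v + T p u' v) ->
  (forall p (t : R) u v, T p (t%:C *: u) v = t%:C *: T p u v) ->
  (forall p u v v', T p u (v + v') = T p u v + T p u v') ->
  (forall p (t : R) u v, T p u (t%:C *: v) = t%:C *: T p u v) ->
  (forall p v, T p (val p) v = 0) ->
  (forall p u v, rdot (T p u v) (val p) = 0) ->
  (forall p u v w, rdot (T p u w) v = - rdot (T p u v) w) ->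
  (forall s p q u v, SU s -> val q = s *m val p ->
     T q (s *m u) (s *m v) = s *m T p u v) ->
  exists a b c : R, forall p u v, rdot u (val p) = 0 -> rdot v (val p) = 0 ->
    T p u v = sasaki_tensor a b c p u v.
Proof.
move=> n4 TDl TZl TDr TZr T0 Tt Tskew Tact; have [p0 p0E] := basepoint_exists.
have n0 : (0 < n)%N by apply: leq_trans n4.
have m0 : (ord_max : 'I_n.+1) != 0 by rewrite -val_eqE /= -lt0n.
pose e : V := delta_mx ord_max 0; pose ie : V := iC *: e; pose ie0 : V := iC *: delta_mx 0 0.
(* Chosen, in view of [basepoint_form], so that [F] below vanishes at the three test values. *)
pose a := rdot (T p0 e ie) ie0; pose b := - rdot (T p0 e e) ie0.
pose c := - rdot (T p0 ie0 e) ie.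
exists a, b, c.
(* [sasaki_form] alone does not vanish when an argument is [val p0]; projecting its arguments gives
   it this property, which [T p0] already has. *)
pose P u : V := tangent_field u p0.
have PD u v : P (u + v) = P u + P v by exact: tangent_fieldD.
have PZ (t : R) u : P (t%:C *: u) = t%:C *: P u by exact: tangent_fieldZ.
have P0 : P (delta_mx 0 0) = 0 by rewrite -p0E; exact: tangent_field_normal.
have Pid u : rdot u (val p0) = 0 -> P u = u by exact: tangent_field_id.
pose F u v w := rdot (T p0 u v) w - sasaki_form a b c p0 (P u) (P v) (P w).
have [te tie tie0] := basepoint_tangent p0E m0.
have [f1 f2 f3 _ _] := basepoint_form p0E m0 a b c.
have F0 u v w : F u v w = 0.
  apply: (@invariant_trilinear_eq0 R n F _ _ _ _ _ _ _ _ n4 ord_max m0); rewrite /F.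
  - by move=> x x' y z; rewrite (TDl p0 x x' y) rdotDl (PD x x') sasaki_formDl opprD addrACA.
  - by move=> t x y z; rewrite (TZl p0 t x y) rdotZl (PZ t x) sasaki_formZl [RHS]mulrBr.
  - by move=> x y y' z; rewrite (TDr p0 x y y') rdotDl (PD y y') sasaki_formDm opprD addrACA.
  - by move=> t x y z; rewrite (TZr p0 t x y) rdotZl (PZ t y) sasaki_formZm [RHS]mulrBr.
  - by move=> x y z; rewrite (Tskew p0 x y z) sasaki_form_skew; exact: esym (opprD _ _).
  - by move=> y z; rewrite P0 sasaki_form0l subr0 -p0E T0 rdot0l.
  - by move=> x z; rewrite P0 sasaki_form0m subr0 Tskew -p0E Tt oppr0.
  - move=> s sS se x y z; have sp : s *m val p0 = val p0 by rewrite p0E.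
    have Ps t : P (s *m t) = s *m P t by exact: tangent_field_act sS.1 (esym sp) t.
    rewrite (Tact _ _ _ _ _ sS (esym sp)) (rdot_unitary _ _ sS.1) !Ps.
    by rewrite (sasaki_form_act _ _ _ _ _ _ sS.1 sp).
  - by rewrite (Pid _ te) (Pid _ tie0) f1 opprK subrr.
  - by rewrite (Pid _ te) (Pid _ tie) (Pid _ tie0) f2 subrr.
  - by rewrite (Pid _ te) (Pid _ tie) (Pid _ tie0) f3 opprK subrr.
have TE u v : rdot u (val p0) = 0 -> rdot v (val p0) = 0 ->
    T p0 u v = sasaki_tensor a b c p0 u v.
  (* Both tensors take tangent values, so only the tangential part of [w] matters; the difference is
     then paired with itself. *)
  move=> up vp; have nondeg w : rdot (T p0 u v - sasaki_tensor a b c p0 u v) w = 0.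
    have := F0 u v w; rewrite /F (Pid _ up) (Pid _ vp) rdotBl.
    rewrite -(rdot_tangent_field w (sasaki_tensor_tangent a b c v up)).
    rewrite rdot_sasaki_tensor //; exact: vfield_tangent (vfield_tangent_field w).
  by apply/eqP; rewrite -subr_eq0; apply/eqP/rdot_eq0/nondeg.
(* Both sides are equivariant, so an [s] that maps [p0] to [p] carries the identity from [p0] to
   [p]. *)
move=> p u v up vp; have [s [sS se]] := SU_transitive p n0.
have sp : val p = s *m val p0 by rewrite p0E se.
have sunit := unitarymx_unit sS.1.
have pull t : rdot t (val p) = 0 -> rdot (invmx s *m t) (val p0) = 0.
  by move=> tp; rewrite -(rdot_unitary _ _ sS.1) mulKVmx // -sp.
rewrite -(mulKVmx sunit u) -(mulKVmx sunit v) (Tact _ _ _ _ _ sS sp).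
by rewrite (sasaki_tensor_act sS.1 sp) TE //; apply: pull.
Qed.

End Classification.

(** * Torsion *)

Section Torsion.
Context {R : realType} {n : nat}.

Local Notation V := 'cV[R[i]]_n.+1.
Local Notation iC := (Complex (0 : R) 1).
Implicit Types (p : sphere R n) (x y z : V) (X Y Z : sphere R n -> V).

Local Opaque tangent_field sasaki_tensor.

Variable nabla : operator R n.
Hypothesis nabla_conn : affine_connection nabla.
Variables a b c : R.
Hypothesis nablaE : forall X Y p, vfield X -> vfield Y ->
  nabla X Y p = levi_civita X Y p + sasaki_tensor a b c p (X p) (Y p).

(** As [levi_civita] is torsion-free, the torsion of [nabla] is the antisymmetrization of
    [sasaki_tensor]; this is the corresponding trilinear form. *)
Definition torsion_form p x y z : R :=
  sasaki_form a b c p x y z - sasaki_form a b c p y x z.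

Lemma torsion_tensor X Y p : vfield X -> vfield Y ->
  torsion nabla X Y p =
  sasaki_tensor a b c p (X p) (Y p) - sasaki_tensor a b c p (Y p) (X p).
Proof.
move=> Xv Yv; have [_ _ lc_tf] := @levi_civita_is_levi_civita R n.
have := lc_tf X Y Xv Yv p; rewrite /torsion (nablaE p Xv Yv) (nablaE p Yv Xv).
move: (levi_civita X Y p) (levi_civita Y X p) (lie_bracket X Y p) => l1 l2 l3 e.
move: (sasaki_tensor _ _ _ _ _ _) (sasaki_tensor _ _ _ _ _ _) => s1 s2.
by rewrite -[RHS]add0r -e; apply/matrixP => i j; rewrite !mxE; ring.
Qed.

Lemma rdot_torsion X Y Z p : vfield X -> vfield Y -> vfield Z ->
  rdot (torsion nabla X Y p) (Z p) = torsion_form p (X p) (Y p) (Z p).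
Proof.
move=> Xv Yv Zv; have Xp := vfield_tangent p Xv; have Yp := vfield_tangent p Yv.
have Zp := vfield_tangent p Zv.
apply: etrans (congr1 (fun t => rdot t (Z p)) (torsion_tensor p Xv Yv)) _.
apply: etrans (rdotBl _ _ _) _; rewrite /torsion_form.
congr (_ - _); exact: rdot_sasaki_tensor.
Qed.

(** [sasaki_tensor] applied to vector fields is [nabla] minus [levi_civita], so its smoothness is
    inherited from the two connections. *)
Lemma vfield_torsion X Y : vfield X -> vfield Y -> vfield (torsion nabla X Y).
Proof.
move=> Xv Yv; have Dv U W : vfield U -> vfield W ->
    vfield (fun p => sasaki_tensor a b c p (U p) (W p)).
  move=> Uv Wv; have [lc_conn _ _] := @levi_civita_is_levi_civita R n.
  have := vfieldB (conn_vfield nabla_conn Uv Wv) (conn_vfield lc_conn Uv Wv).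
  by congr vfield; apply/funext => p; rewrite nablaE // addrAC subrr add0r.
have := vfieldB (Dv X Y Xv Yv) (Dv Y X Yv Xv).
by congr vfield; apply/funext => p; rewrite torsion_tensor.
Qed.

Lemma totally_skew_torsion_coef : (0 < n)%N -> totally_skew_torsion nabla ->
  b = 0 /\ c = - a.
Proof.
(* [r1], [r2], [r3] stand for [a], [b], [c]. The equations express skewness in the last two
   arguments at [(e, i e, i e_0)] and at [(i e_0, e, e)]. *)
have coef (r1 r2 r3 : R) : - r1 - - r3 = - (r1 - - r1) ->
    0 - - - r2 = - (0 - - - r2) -> r2 = 0 /\ r3 = - r1.
  by move=> e1 e2; split; lra.
move=> n0 [_ _ _ _ skew]; have [p0 p0E] := @basepoint_exists R n.
have m0 : (ord_max : 'I_n.+1) != 0 by rewrite -val_eqE /= -lt0n.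
have [te tie tie0] := basepoint_tangent p0E m0.
have [f1 f2 f3 f4 f5] := basepoint_form p0E m0 a b c.
have tf x y z : rdot x (val p0) = 0 -> rdot y (val p0) = 0 -> rdot z (val p0) = 0 ->
    rdot (torsion nabla (tangent_field x) (tangent_field y) p0) (tangent_field z p0) =
    torsion_form p0 x y z.
  move=> xp yp zp; have tv := @vfield_tangent_field R n.
  apply: etrans (rdot_torsion p0 (tv x) (tv y) (tv z)) _.
  by rewrite !tangent_field_id.
have sk x y z : rdot x (val p0) = 0 -> rdot y (val p0) = 0 -> rdot z (val p0) = 0 ->
    torsion_form p0 x z y = - torsion_form p0 x y z.
  move=> xp yp zp; have tv := @vfield_tangent_field R n.
  apply: etrans (esym (tf x z y xp zp yp)) (etrans (skew _ _ _ (tv x) (tv y) (tv z) p0) _).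
  by congr (- _); exact: tf.
have g1 := sasaki_form_skew a b c p0 (delta_mx ord_max 0) (delta_mx ord_max 0)
  (iC *: delta_mx 0 0).
have g2 := sasaki_form_skew a b c p0 (delta_mx ord_max 0) (iC *: delta_mx ord_max 0)
  (iC *: delta_mx 0 0).
have := sk _ _ _ tie0 te te; have := sk _ _ _ te tie tie0.
rewrite /torsion_form g1 g2 f1 f2 f3 f4 f5.
exact: coef.
Qed.

Lemma totally_skew_torsion_of_coef : b = 0 -> c = - a -> totally_skew_torsion nabla.
Proof.
move=> b0 ca.
(* [2 a] times the cyclic sum of [g(x, i y) eta(z)], that is, a multiple of the wedge product of eta
   and Phi. For [b = 0] and [c = - a] the form of the tensor is already skew, so antisymmetrizing in
   [x] and [y] doubles it. *)
pose form p x y z := 2 * a * (rdot x (iC *: y) * sasaki_eta p z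
    - sasaki_eta p y * rdot x (iC *: z) + sasaki_eta p x * rdot y (iC *: z)).
have formE X Y Z p : vfield X -> vfield Y -> vfield Z ->
    rdot (torsion nabla X Y p) (Z p) = form p (X p) (Y p) (Z p).
  move=> Xv Yv Zv; apply: etrans (rdot_torsion p Xv Yv Zv) _.
  move: (X p) (Y p) (Z p) => x y z.
  by rewrite /torsion_form /sasaki_form /form b0 ca (rdot_mulIC x y); ring.
split.
- move=> X Y Z Xv Yv Zv.
  exact: sphere_smooth_rdot (vfield_smooth (vfield_torsion Xv Yv)) (vfield_smooth Zv).
- move=> X X' Y Z Xv X'v Yv Zv p; apply: etrans (formE _ _ _ p (vfieldD Xv X'v) Yv Zv) _.
  apply: etrans (esym (congr2 (fun s t => s + t) (formE _ _ _ p Xv Yv Zv)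
    (formE _ _ _ p X'v Yv Zv))).
  by move: (X p) (X' p) (Y p) (Z p) => x x' y z; rewrite /form !rdotDl sasaki_etaD; ring.
- move=> f X Y Z fS Xv Yv Zv p; apply: etrans (formE _ _ _ p (vfieldZ fS Xv) Yv Zv) _.
  apply: etrans (esym (congr1 (fun t => f p * t) (formE _ _ _ p Xv Yv Zv))).
  by move: (X p) (Y p) (Z p) => x y z; rewrite /form !rdotZl sasaki_etaZ; ring.
- move=> X Y Z Xv Yv Zv p; apply: etrans (formE _ _ _ p Yv Xv Zv) _.
  apply: etrans (esym (congr1 (fun t => - t) (formE _ _ _ p Xv Yv Zv))).
  by move: (X p) (Y p) (Z p) => x y z; rewrite /form (rdot_mulIC x y); ring.
- move=> X Y Z Xv Yv Zv p; apply: etrans (formE _ _ _ p Xv Zv Yv) _.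
  apply: etrans (esym (congr1 (fun t => - t) (formE _ _ _ p Xv Yv Zv))).
  by move: (X p) (Y p) (Z p) => x y z; rewrite /form (rdot_mulIC y z); ring.
Qed.

End Torsion.

Theorem theorem4p9 (R : realType) (n : nat) (n_ge4 : (4 <= n)%N)
    (nabla : operator R n) (nabla_conn : affine_connection nabla)
    (nabla_metric : metric_connection nabla) (nabla_inv : SU_invariant nabla) :
  (exists (q : R[i]) (t : R),
     forall X Y : sphere R n -> 'cV[R[i]]_n.+1, vfield X -> vfield Y ->
     forall p : sphere R n,
       nabla X Y p =
         levi_civita X Y p
         + (complex.Re q - 1)%:C *:
             ((sasaki_Phi p (X p) (Y p))%:C *: sasaki_xi p
              + (sasaki_eta p (Y p))%:C *: sasaki_psi p (X p))
         + (complex.Im q)%:C *: nabla_psi levi_civita X Y p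
         + ((t + n%:R^-1) * sasaki_eta p (X p))%:C *: sasaki_psi p (Y p))
  /\
  (totally_skew_torsion nabla <->
   exists r : R,
     forall X Y : sphere R n -> 'cV[R[i]]_n.+1, vfield X -> vfield Y ->
     forall p : sphere R n,
       nabla X Y p =
         levi_civita X Y p
         + r%:C *:
             ((sasaki_Phi p (X p) (Y p))%:C *: sasaki_xi p
              - (sasaki_eta p (X p))%:C *: sasaki_psi p (Y p)
              + (sasaki_eta p (Y p))%:C *: sasaki_psi p (X p))).
Proof.
(* The one-parameter family of the second claim is the case [b = 0], [c = - a] of
   [sasaki_tensor]. *)
have skewE r p (u v : 'cV[R[i]]_n.+1) :
    r%:C *: ((sasaki_Phi p u v)%:C *: sasaki_xi p
             - (sasaki_eta p u)%:C *: sasaki_psi p v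
             + (sasaki_eta p v)%:C *: sasaki_psi p u) =
    sasaki_tensor r 0 (- r) p u v.
  rewrite /sasaki_tensor scaleC0 addr0 mulNr scaleCN scaleCM -scalerBr.
  by rewrite addrAC.
have [T [nablaE [TDl TZl TDr TZr T0] T_tangent T_skew T_act]] :=
  difference_tensor nabla_conn nabla_metric nabla_inv.
have [a [b [c TE]]] := tensor_classification n_ge4 TDl TZl TDr TZr T0 T_tangent T_skew T_act.
have {nablaE TE} nablaE X Y p : vfield X -> vfield Y ->
    nabla X Y p = levi_civita X Y p + sasaki_tensor a b c p (X p) (Y p).
  by move=> Xv Yv; rewrite nablaE // TE //; apply: vfield_tangent.
split.
  (* Solves [Re q - 1 = a], [Im q = b] and [t + 1/n = c]. *)
  exists ((a + 1) +i* b), (c - n%:R^-1) => X Y Xv Yv p.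
  by rewrite nablaE // nabla_psi_levi_civita //= addrK subrK /sasaki_tensor !addrA.
have n0 : (0 < n)%N by apply: leq_trans n_ge4.
split=> [skew|[r rE]].
  have [b0 ca] := totally_skew_torsion_coef nablaE n0 skew.
  by exists a => X Y Xv Yv p; rewrite nablaE // skewE b0 ca.
apply: (@totally_skew_torsion_of_coef _ _ _ nabla_conn r 0 (- r)) => // X Y p Xv Yv.
by rewrite rE // skewE.
Qed.
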